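(* Let $M_1>0$, $M_2>0$. Let $F(z)=\bar{z}G(z)+H(z)$, $z\in\mathbb{D}$, where $G,H$ are analytic in $\mathbb{D}$, $G\not\equiv 0$, $G(0)=H(0)=0$, $G'(0)=H'(0)=1$, $|G(z)|\leq M_1$ and $|H(z)|\leq M_2$ for all $z\in\mathbb{D}$. Let $\rho_3$ be the unique root in $(0,1)$ of the equation $$1-\Big(M_2-\frac{1}{M_2}\Big)\frac{2r-r^2}{(1-r)^2}-\Big(M_1-\frac{1}{M_1}\Big)\frac{(3-2r)r^2}{(1-r)^2}-2r=0.$$ Then $F$ is sense-preserving, univalent and fully starlike in $\mathbb{D}_{\rho_3}$.
   Context: $\mathbb{D}=\{z:|z|<1\}$, $\mathbb{D}_r=\{z:|z|<r\}$. For a continuously differentiable $F$, $F_z=\frac12(F_x-iF_y)$, $F_{\bar z}=\frac12(F_x+iF_y)$, and the Jacobian is $J_F=|F_z|^2-|F_{\bar z}|^2$; $F$ is sense-preserving on a domain if $J_F>0$ there. $F$ is fully starlike in $\mathbb{D}_r$ if it is sense-preserving there, $F(0)=0$, $F(z)\neq 0$ for $z\in\mathbb{D}_r\setminus\{0\}$, and for each $s\in(0,r)$ the curve $t\mapsto F(se^{it})$ is starlike with respect to the origin, i.e. $\mathrm{Re}\big((zF_z(z)-\bar zF_{\bar z}(z))/F(z)\big)>0$ for all $|z|=s$. *)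

(* Defs.v *)
From Stdlib Require Import Reals.
From Coquelicot Require Import Coquelicot.
Open Scope R_scope.

Definition holo_on (r : R) (f : C -> C) : Prop :=
  forall z : C, Cmod z < r -> @ex_derive C_AbsRing C_NormedModule f z.

Definition partials (F : C -> C) (z Fx Fy : C) : Prop :=
  @is_derive R_AbsRing C_R_NormedModule (fun t : R => F (Cplus z (RtoC t))) 0 Fx /\
  @is_derive R_AbsRing C_R_NormedModule (fun t : R => F (Cplus z (0, t))) 0 Fy.

Definition wirtinger (F : C -> C) (z Fz Fzb : C) : Prop :=
  exists Fx Fy : C, partials F z Fx Fy /\
    Fz = Cmult (RtoC (/2)) (Cminus Fx (Cmult Ci Fy)) /\
    Fzb = Cmult (RtoC (/2)) (Cplus Fx (Cmult Ci Fy)).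

Definition jac (Fz Fzb : C) : R := Cmod Fz ^ 2 - Cmod Fzb ^ 2.

Definition sense_preserving_in (r : R) (F : C -> C) : Prop :=
  forall z : C, Cmod z < r ->
    exists Fz Fzb, wirtinger F z Fz Fzb /\ jac Fz Fzb > 0.

Definition univalent_in (r : R) (F : C -> C) : Prop :=
  forall z w : C, Cmod z < r -> Cmod w < r -> F z = F w -> z = w.

Definition fully_starlike_in (r : R) (F : C -> C) : Prop :=
  sense_preserving_in r F /\ F (RtoC 0) = RtoC 0 /\
  (forall z : C, 0 < Cmod z < r -> F z <> RtoC 0) /\
  (forall z : C, 0 < Cmod z < r ->
     exists Fz Fzb, wirtinger F z Fz Fzb /\
       0 < Re (Cdiv (Cminus (Cmult z Fz) (Cmult (Cconj z) Fzb)) (F z))).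

Definition rho3_eq (M1 M2 r : R) : R :=
  1 - (M2 - / M2) * ((2 * r - r ^ 2) / (1 - r) ^ 2)
    - (M1 - / M1) * ((3 - 2 * r) * r ^ 2 / (1 - r) ^ 2) - 2 * r.

(* Main.v *)
(** Write F(z) = conj(z) G(z) + H(z), so that F_z = conj(z) G' + H' and F_zbar = G.  Everything
    follows from two bounds for an analytic f on the disc with f(0) = 0, f'(0) = 1, |f| <= M:
      |f(z) - z| <= (M - 1/M) r^2/(1-r)   and   |z f'(z) - f(z)| <= (M - 1/M) r^2/(1-r)^2,
    where r = |z|.  They add up to the power series estimates obtained from |a_n| <= M - 1/M, but
    are derived here without power series, by applying the Schwarz-Pick inequalities to
    g(z) = f(z)/(M z), for which g(0) = 1/M.

    Schwarz-Pick rests on the maximum principle for functions that are continuous in the disc and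
    complex differentiable off finitely many points.  The maximum principle rests on the mean value
    property, which is Goursat's theorem for f(z0 + exp(s + i t)) on a rectangle of width 2 pi,
    followed by a passage to the limit s -> -infinity.

    With A = z F_z - conj(z) F_zbar, the bounds show that on |z| < rho_3 both |F_z - 1| + |F_zbar| < 1
    and |A - F| < |F|.  The first gives the Jacobian condition and univalence, the second gives
    F <> 0 and Re (A/F) > 0. *)

Require Import Defs.
From Stdlib Require Import Reals.
From Coquelicot Require Import Coquelicot.
From Stdlib Require Import Lra ClassicalEpsilon.
Open Scope R_scope.

(** * Goursat's theorem *)

Section RectInduction.
Variables (P : R -> R -> R -> R -> Prop) (a b w k : R).
Let m (n : nat) := / 2 ^ n.

(** Selects a quarter on which [P] fails. The fourth quarter is an untested default: once the other
    three are good and the whole is bad, the splitting hypothesis of [rect_induction] makes it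
    bad. *)
Definition bad_corner (n : nat) (p : R * R) : R * R :=
  let (x, y) := p in
  let w' := w * m (S n) in let k' := k * m (S n) in
  if excluded_middle_informative (~ P x y w' k') then (x, y)
  else if excluded_middle_informative (~ P (x + w') y w' k') then (x + w', y)
  else if excluded_middle_informative (~ P x (y + k') w' k') then (x, y + k')
  else (x + w', y + k').

Fixpoint bad_seq (n : nat) : R * R :=
  match n with O => (a, b) | S n => bad_corner n (bad_seq n) end.

(** Nested intervals: left ends increase, right ends decrease and the lengths tend to 0, so both
    sequences share a limit lying in every interval. *)
Lemma halving_limit (x : nat -> R) (l : R) : 0 <= l ->
  (forall n, x n <= x (S n) /\ x (S n) + l * m (S n) <= x n + l * m n) ->
  exists p, forall n, x n <= p <= x n + l * m n.
Proof.
  intros Hl Hx.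
  assert (Hm : forall n, 0 < m n).
  { intros n; apply Rinv_0_lt_compat, pow_lt; lra. }
  destruct (ex_lim_seq_adj x (fun n => x n + l * m n)) as [Hu [Hv Huv]].
  - intros n; apply Hx.
  - intros n; apply Hx.
  - apply is_lim_seq_ext with (fun n => l * (/ 2) ^ n).
    + intros n; unfold m; rewrite pow_inv; ring.
    + replace (Finite 0) with (Rbar_mult l 0) by (simpl; f_equal; ring).
      apply is_lim_seq_scal_l, is_lim_seq_geom.
      rewrite Rabs_pos_eq; lra.
  - exists (real (Lim_seq x)); intros n; split.
    + apply is_lim_seq_incr_compare; [apply Lim_seq_correct', Hu | intros j; apply Hx].
    + rewrite Huv.
      apply (is_lim_seq_decr_compare (fun n => x n + l * m n));
        [apply Lim_seq_correct', Hv | intros j; apply Hx].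
Qed.

(* All rectangles [x, x + w] x [y, y + k] met by the bisection have the shape of the initial one, so
   in the local hypothesis the squared diameter is comparable to the area. *)
Lemma rect_induction : 0 <= w -> 0 <= k ->
  (forall x y w k, P x y (w / 2) (k / 2) -> P (x + w / 2) y (w / 2) (k / 2) ->
     P x (y + k / 2) (w / 2) (k / 2) -> P (x + w / 2) (y + k / 2) (w / 2) (k / 2) ->
     P x y w k) ->
  (forall p q, a <= p <= a + w -> b <= q <= b + k ->
     exists d, 0 < d /\ forall x y n,
       x <= p <= x + w * / 2 ^ n -> y <= q <= y + k * / 2 ^ n ->
       a <= x -> x + w * / 2 ^ n <= a + w -> b <= y -> y + k * / 2 ^ n <= b + k ->
       w * / 2 ^ n < d -> k * / 2 ^ n < d -> P x y (w * / 2 ^ n) (k * / 2 ^ n)) ->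
  P a b w k.
Proof.
  intros Hw Hk Hsplit Hloc.
  apply NNPP; intros Hbad.
  assert (Hm : forall n, 0 < m n).
  { intros n; apply Rinv_0_lt_compat, pow_lt; lra. }
  assert (Hms : forall n, m n = 2 * m (S n)).
  { intros n; unfold m; simpl; field; apply pow_nonzero; lra. }
  assert (HB : forall n, ~ P (fst (bad_seq n)) (snd (bad_seq n)) (w * m n) (k * m n)).
  { induction n as [|n IH].
    - unfold m; simpl; rewrite Rinv_1, !Rmult_1_r; exact Hbad.
    - simpl bad_seq; destruct (bad_seq n) as [x y]; simpl in IH; unfold bad_corner.
      destruct excluded_middle_informative as [H1|H1]; [exact H1|].
      destruct excluded_middle_informative as [H2|H2]; [exact H2|].
      destruct excluded_middle_informative as [H3|H3]; [exact H3|].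
      intros H4; apply IH; apply NNPP in H1, H2, H3; simpl in H4.
      apply Hsplit; replace (w * m n / 2) with (w * m (S n)) by (rewrite (Hms n); field);
        replace (k * m n / 2) with (k * m (S n)) by (rewrite (Hms n); field); assumption. }
  assert (Hmono : forall n,
    (fst (bad_seq n) <= fst (bad_seq (S n)) /\
     fst (bad_seq (S n)) + w * m (S n) <= fst (bad_seq n) + w * m n) /\
    (snd (bad_seq n) <= snd (bad_seq (S n)) /\
     snd (bad_seq (S n)) + k * m (S n) <= snd (bad_seq n) + k * m n)).
  { intros n; simpl bad_seq; destruct (bad_seq n) as [x y]; unfold bad_corner.
    rewrite (Hms n).
    assert (0 <= w * m (S n)) by (apply Rmult_le_pos; [lra | left; apply Hm]).
    assert (0 <= k * m (S n)) by (apply Rmult_le_pos; [lra | left; apply Hm]).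
    repeat destruct excluded_middle_informative; simpl; lra. }
  destruct (halving_limit (fun n => fst (bad_seq n)) w Hw) as [p Hp].
  { intros n; apply Hmono. }
  destruct (halving_limit (fun n => snd (bad_seq n)) k Hk) as [q Hq].
  { intros n; apply Hmono. }
  assert (Hin : forall n, a <= fst (bad_seq n) /\ fst (bad_seq n) + w * m n <= a + w /\
                          b <= snd (bad_seq n) /\ snd (bad_seq n) + k * m n <= b + k).
  { induction n as [|n IH].
    - unfold m; simpl; rewrite Rinv_1; lra.
    - specialize (Hmono n); lra. }
  assert (H0p := Hp O); assert (H0q := Hq O); unfold m in H0p, H0q; simpl in H0p, H0q.
  rewrite Rinv_1 in H0p, H0q.
  destruct (Hloc p q) as [d [Hd HP]]; [lra | lra |].
  (* The sum [w + k] controls both sides at once, so a single index [N] brings both below [d]. *)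
  assert (Hlim : is_lim_seq (fun n => (w + k) * (/ 2) ^ n) 0).
  { replace (Finite 0) with (Rbar_mult (w + k) 0) by (simpl; f_equal; ring).
    apply is_lim_seq_scal_l, is_lim_seq_geom.
    rewrite Rabs_pos_eq; lra. }
  apply is_lim_seq_spec in Hlim.
  destruct (Hlim (mkposreal d Hd)) as [N HN].
  specialize (HN N (le_n N)); simpl in HN.
  rewrite Rminus_0_r, pow_inv in HN.
  apply Rabs_def2 in HN; destruct HN as [HN _]; fold (m N) in HN.
  assert (Hw' : 0 <= w * m N) by (apply Rmult_le_pos; [lra | left; apply Hm]).
  assert (Hk' : 0 <= k * m N) by (apply Rmult_le_pos; [lra | left; apply Hm]).
  apply (HB N), HP; fold (m N); try (apply Hp || apply Hq || apply Hin); lra.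
Qed.
End RectInduction.

(* The integral of [u dt + v ds] over the boundary, for sides [w] in [s] and [k] in [t]. *)
Definition flux (u v : R -> R -> R) (x y w k : R) : R :=
  RInt (fun t => u (x + w) t - u x t) y (y + k)
  - RInt (fun s => v s (y + k) - v s y) x (x + w).

Lemma continuity_2d_pt_slice1 (u : R -> R -> R) (s t : R) :
  continuity_2d_pt u s t -> continuous (fun s => u s t) s.
Proof.
  intros H; apply continuity_pt_filterlim.
  intros eps Heps; destruct (H (mkposreal eps Heps)) as [d Hd].
  exists d; split; [apply cond_pos|].
  intros x [_ Hx]; apply Hd; [exact Hx | rewrite Rminus_diag, Rabs_R0; apply cond_pos].
Qed.

Lemma continuity_2d_pt_slice2 (u : R -> R -> R) (s t : R) :
  continuity_2d_pt u s t -> continuous (fun t => u s t) t.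
Proof.
  intros H; apply continuity_pt_filterlim.
  intros eps Heps; destruct (H (mkposreal eps Heps)) as [d Hd].
  exists d; split; [apply cond_pos|].
  intros x [_ Hx]; apply Hd; [rewrite Rminus_diag, Rabs_R0; apply cond_pos | exact Hx].
Qed.

Lemma RInt_near_const (f : R -> R) (x l c e : R) : 0 <= l ->
  ex_RInt f x (x + l) -> (forall t, x <= t <= x + l -> Rabs (f t - c) <= e) ->
  Rabs (RInt f x (x + l) - l * c) <= l * e.
Proof.
  intros Hl Hf He.
  replace (RInt f x (x + l) - l * c) with (RInt (fun t => minus (f t) c) x (x + l)).
  - replace (l * e) with ((x + l - x) * e) by ring.
    apply abs_RInt_le_const; [lra | | exact He].
    apply (ex_RInt_minus f (fun _ => c)); [exact Hf | apply ex_RInt_const].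
  - rewrite (RInt_minus f (fun _ => c)); [| exact Hf | apply ex_RInt_const].
    rewrite RInt_const; unfold minus, plus, opp, scal; simpl; unfold mult; simpl; ring.
Qed.

Section Goursat.
Variables (u v : R -> R -> R) (a b w k : R).
Hypothesis Hcont : forall s t, a <= s <= a + w -> b <= t <= b + k ->
  continuity_2d_pt u s t /\ continuity_2d_pt v s t.

Lemma ex_RInt_vertical (x y l : R) : a <= x <= a + w -> b <= y -> 0 <= l -> y + l <= b + k ->
  ex_RInt (fun t => u x t) y (y + l).
Proof.
  intros Hx Hy Hl Hyl; apply (ex_RInt_continuous (V := R_CompleteNormedModule)); intros t.
  rewrite Rmin_left, Rmax_right by lra; intros Ht.
  apply continuity_2d_pt_slice2, Hcont; lra.
Qed.

Lemma ex_RInt_horizontal (x y l : R) : b <= y <= b + k -> a <= x -> 0 <= l -> x + l <= a + w ->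
  ex_RInt (fun s => v s y) x (x + l).
Proof.
  intros Hx Hy Hl Hyl; apply (ex_RInt_continuous (V := R_CompleteNormedModule)); intros t.
  rewrite Rmin_left, Rmax_right by lra; intros Ht.
  apply (continuity_2d_pt_slice1 v), Hcont; lra.
Qed.

(** Each inner side occurs twice with opposite signs, and the halves of the outer sides are joined
    by Chasles' relation. *)
Lemma flux_split (x y w' k' : R) : 0 <= w' -> 0 <= k' ->
  a <= x -> x + w' <= a + w -> b <= y -> y + k' <= b + k ->
  flux u v x y w' k' =
    flux u v x y (w' / 2) (k' / 2) + flux u v (x + w' / 2) y (w' / 2) (k' / 2)
    + flux u v x (y + k' / 2) (w' / 2) (k' / 2)
    + flux u v (x + w' / 2) (y + k' / 2) (w' / 2) (k' / 2).
Proof.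
  intros Hw Hk H1 H2 H3 H4; unfold flux.
  replace (x + w' / 2 + w' / 2) with (x + w') by field.
  replace (y + k' / 2 + k' / 2) with (y + k') by field.
  assert (EU : forall x1 x2 y l, a <= x1 <= a + w -> a <= x2 <= a + w -> b <= y -> 0 <= l ->
    y + l <= b + k -> RInt (fun t => u x1 t - u x2 t) y (y + l)
      = RInt (u x1) y (y + l) - RInt (u x2) y (y + l)).
  { intros; apply (RInt_minus (u x1) (u x2)); apply ex_RInt_vertical; lra. }
  assert (EV : forall y1 y2 x l, b <= y1 <= b + k -> b <= y2 <= b + k -> a <= x -> 0 <= l ->
    x + l <= a + w -> RInt (fun s => v s y1 - v s y2) x (x + l)
      = RInt (fun s => v s y1) x (x + l) - RInt (fun s => v s y2) x (x + l)).
  { intros; apply (RInt_minus (fun s => v s y1) (fun s => v s y2));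
    apply ex_RInt_horizontal; lra. }
  assert (CU : forall x1, a <= x1 <= a + w ->
    RInt (u x1) y (y + k') = RInt (u x1) y (y + k' / 2) + RInt (u x1) (y + k' / 2) (y + k')).
  { intros x1 Hx1; symmetry; apply (RInt_Chasles (V := R_CompleteNormedModule)); [apply ex_RInt_vertical; lra |].
    replace (y + k') with (y + k' / 2 + k' / 2) by field; apply ex_RInt_vertical; lra. }
  assert (CV : forall y1, b <= y1 <= b + k ->
    RInt (fun s => v s y1) x (x + w')
    = RInt (fun s => v s y1) x (x + w' / 2) + RInt (fun s => v s y1) (x + w' / 2) (x + w')).
  { intros y1 Hy1; symmetry; apply (RInt_Chasles (V := R_CompleteNormedModule)); [apply ex_RInt_horizontal; lra |].
    replace (x + w') with (x + w' / 2 + w' / 2) by field; apply ex_RInt_horizontal; lra. }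
  rewrite !EU, !EV by lra.
  (* Instances for the upper and right halves, whose end point must read [y + k'] or [x + w'] for
     the rewriting to match. *)
  assert (EU' := fun x1 x2 H1 H2 => EU x1 x2 (y + k' / 2) (k' / 2) H1 H2).
  assert (EV' := fun x1 x2 H1 H2 => EV x1 x2 (x + w' / 2) (w' / 2) H1 H2).
  replace (y + k' / 2 + k' / 2) with (y + k') in EU' by field.
  replace (x + w' / 2 + w' / 2) with (x + w') in EV' by field.
  rewrite !EU', !EV', !CU, !CV by lra; lra.
Qed.

Hypothesis Hdiff : forall s t, a <= s <= a + w -> b <= t <= b + k ->
  exists A B C, differentiable_pt_lim u s t A B /\ differentiable_pt_lim v s t C A.

(** The shared [A] in [Hdiff] is the Cauchy-Riemann equation [u_s = v_t]. On a small rectangle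
    around a point the linear parts of the two integrals are then both [A] times the area and
    cancel, so the flux is at most [eps] times the area. This bound is additive under splitting,
    hence global by [rect_induction]. *)
Lemma goursat : 0 < w -> 0 < k -> flux u v a b w k = 0.
Proof.
  intros Hw Hk.
  assert (Hwk : 0 < w * k) by (apply Rmult_lt_0_compat; lra).
  enough (Heps : forall eps, 0 < eps -> Rabs (flux u v a b w k) <= eps * (w * k)).
  { apply NNPP; intros Hne; apply Rabs_pos_lt in Hne.
    specialize (Heps (Rabs (flux u v a b w k) / (2 * (w * k)))).
    replace (Rabs (flux u v a b w k) / (2 * (w * k)) * (w * k))
      with (Rabs (flux u v a b w k) / 2) in Heps by (field; lra).
    enough (0 < Rabs (flux u v a b w k) / (2 * (w * k))) by (specialize (Heps H); lra).
    apply Rdiv_lt_0_compat; lra. }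
  intros eps Heps.
  apply (rect_induction (fun x y w' k' => 0 <= w' -> 0 <= k' ->
    a <= x -> x + w' <= a + w -> b <= y -> y + k' <= b + k ->
    Rabs (flux u v x y w' k') <= eps * (w' * k')) a b w k); try lra.
  - intros x y w' k' H1 H2 H3 H4 Hw' Hk' C1 C2 C3 C4.
    rewrite flux_split; try assumption.
    eapply Rle_trans; [apply Rabs_triang|].
    eapply Rle_trans; [apply Rplus_le_compat_r, Rabs_triang|].
    eapply Rle_trans; [apply Rplus_le_compat_r, Rplus_le_compat_r, Rabs_triang|].
    replace (eps * (w' * k')) with (eps * (w' / 2 * (k' / 2)) + eps * (w' / 2 * (k' / 2))
      + eps * (w' / 2 * (k' / 2)) + eps * (w' / 2 * (k' / 2))) by field.
    repeat apply Rplus_le_compat; [apply H1 | apply H2 | apply H3 | apply H4]; lra.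
  - intros p q Hp Hq.
    destruct (Hdiff p q Hp Hq) as [A [B [C' [HU HV]]]].
    (* Each integrand is a difference of two values, each with error [e * (w * m + k * m)]. The two
       integrals together err by [2 * e * (w * m + k * m) ^ 2], and this [e] makes that equal to
       [eps] times the area. *)
    assert (He : 0 < eps * (w * k) / (2 * (w + k) ^ 2)).
    { apply Rdiv_lt_0_compat; [apply Rmult_lt_0_compat; lra |].
      apply Rmult_lt_0_compat; [lra | apply pow_lt; lra]. }
    set (e := eps * (w * k) / (2 * (w + k) ^ 2)) in He.
    destruct (HU (mkposreal e He)) as [d1 Hd1]; destruct (HV (mkposreal e He)) as [d2 Hd2].
    simpl in Hd1, Hd2.
    exists (Rmin d1 d2); split; [apply Rmin_pos; apply cond_pos |].
    intros x y n Hx Hy Cx1 Cx2 Cy1 Cy2 Hwd Hkd Hw' Hk' _ _ _ _.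
    assert (Hm : 0 < / 2 ^ n) by (apply Rinv_0_lt_compat, pow_lt; lra).
    set (m := / 2 ^ n) in *.
    assert (Hmin1 := Rmin_l d1 d2); assert (Hmin2 := Rmin_r d1 d2).
    assert (Hlin : forall f D E, (forall s t, Rabs (s - p) < Rmin d1 d2 -> Rabs (t - q) < Rmin d1 d2 ->
        Rabs (f s t - f p q - (D * (s - p) + E * (t - q))) <= e * Rmax (Rabs (s - p)) (Rabs (t - q))) ->
      forall s t, x <= s <= x + w * m -> y <= t <= y + k * m ->
        Rabs (f s t - f p q - (D * (s - p) + E * (t - q))) <= e * (w * m + k * m)).
    { intros f D E Hf s t Hs Ht.
      assert (Rabs (s - p) <= w * m) by (apply Rabs_le; lra).
      assert (Rabs (t - q) <= k * m) by (apply Rabs_le; lra).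
      eapply Rle_trans; [apply Hf; lra |].
      apply Rmult_le_compat_l; [lra |]; apply Rmax_lub; lra. }
    assert (HU' := Hlin u A B (fun s t H1 H2 => Hd1 s t (Rlt_le_trans _ _ _ H1 Hmin1) (Rlt_le_trans _ _ _ H2 Hmin1))).
    assert (HV' := Hlin v C' A (fun s t H1 H2 => Hd2 s t (Rlt_le_trans _ _ _ H1 Hmin2) (Rlt_le_trans _ _ _ H2 Hmin2))).
    assert (HI : Rabs (RInt (fun t => u (x + w * m) t - u x t) y (y + k * m) - (k * m) * (A * (w * m)))
      <= (k * m) * (2 * (e * (w * m + k * m)))).
    { apply RInt_near_const; [lra | |].
      - apply (ex_RInt_minus (u (x + w * m)) (u x)); apply ex_RInt_vertical; lra.
      - intros t Ht.
        assert (K1 := HU' (x + w * m) t ltac:(lra) Ht); assert (K2 := HU' x t ltac:(lra) Ht).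
        apply Rabs_le_between in K1, K2; apply Rabs_le; lra. }
    assert (HJ : Rabs (RInt (fun s => v s (y + k * m) - v s y) x (x + w * m) - (w * m) * (A * (k * m)))
      <= (w * m) * (2 * (e * (w * m + k * m)))).
    { apply RInt_near_const; [lra | |].
      - apply (ex_RInt_minus (fun s => v s (y + k * m)) (fun s => v s y)); apply ex_RInt_horizontal; lra.
      - intros t Ht.
        assert (K1 := HV' t (y + k * m) Ht ltac:(lra)); assert (K2 := HV' t y Ht ltac:(lra)).
        apply Rabs_le_between in K1, K2; apply Rabs_le; lra. }
    unfold flux.
    apply Rabs_le_between in HI, HJ; apply Rabs_le.
    assert (Heq : eps * (w * m * (k * m)) = (k * m) * (2 * (e * (w * m + k * m))) + (w * m) * (2 * (e * (w * m + k * m)))).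
    { unfold e; field; lra. }
    rewrite Heq; lra.
Qed.
End Goursat.

(** * The mean value property *)

Definition ccont (f : C -> C) (z : C) : Prop :=
  forall eps, 0 < eps -> exists d, 0 < d /\
    forall w, Cmod (w - z)%C < d -> Cmod (f w - f z)%C < eps.

(* Caratheodory's form of differentiability: the derivative is the value at [z] of a continuous slope. *)
Definition cslope (f : C -> C) (z : C) (phi : C -> C) : Prop :=
  ccont phi z /\ exists d, 0 < d /\
    forall w, Cmod (w - z)%C < d -> f w = (f z + phi w * (w - z))%C.

Definition cderiv (f : C -> C) (z l : C) : Prop := exists phi, phi z = l /\ cslope f z phi.

Lemma im_le_Cmod (z : C) : Rabs (Im z) <= Cmod z.
Proof. eapply Rle_trans; [apply Rmax_r | apply Rmax_Cmod]. Qed.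

Lemma Cmod_le_abs (z : C) : Cmod z <= Rabs (Re z) + Rabs (Im z).
Proof.
  assert (H1 := Rabs_pos (Re z)); assert (H2 := Rabs_pos (Im z)).
  apply Rsqr_incr_0_var; [| lra].
  rewrite !Rsqr_pow2, Cmod2_alt, <- (pow2_abs (Re z)), <- (pow2_abs (Im z)).
  assert (H3 := Rmult_le_pos _ _ H1 H2); lra.
Qed.

Lemma cderiv_ccont (f : C -> C) (z l : C) : cderiv f z l -> ccont f z.
Proof.
  intros [phi [_ [Hphi [d [Hd Hf]]]]] eps Heps.
  destruct (Hphi 1 Rlt_0_1) as [d1 [Hd1 H1]].
  set (K := Cmod (phi z) + 1).
  assert (HK : 0 < K) by (unfold K; assert (H := Cmod_ge_0 (phi z)); lra).
  exists (Rmin d (Rmin d1 (eps / K))); split.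
  - repeat apply Rmin_pos; try assumption; apply Rdiv_lt_0_compat; lra.
  - intros w Hw.
    assert (Hw1 := Rlt_le_trans _ _ _ Hw (Rmin_l _ _)).
    assert (Hw2 := Rlt_le_trans _ _ _ Hw (Rmin_r _ _)).
    assert (Hw3 := Rlt_le_trans _ _ _ Hw2 (Rmin_l _ _)).
    assert (Hw4 := Rlt_le_trans _ _ _ Hw2 (Rmin_r _ _)).
    rewrite (Hf w Hw1).
    replace (f z + phi w * (w - z) - f z)%C with (phi w * (w - z))%C by ring.
    rewrite Cmod_mult.
    assert (Hp : Cmod (phi w) <= K).
    { replace (phi w) with (phi z + (phi w - phi z))%C by ring.
      eapply Rle_trans; [apply Cmod_triangle |]; specialize (H1 w Hw3); unfold K; lra. }
    apply Rle_lt_trans with (K * Cmod (w - z)%C).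
    + apply Rmult_le_compat_r; [apply Cmod_ge_0 | exact Hp].
    + replace eps with (K * (eps / K)) by (field; lra).
      apply Rmult_lt_compat_l; assumption.
Qed.

(** The slope is the difference quotient, completed by [l] at [z]; the little-o estimate divided by
    [w - z] is its continuity there. *)
Lemma is_derive_cderiv (f : C -> C) (z l : C) :
  @is_derive C_AbsRing C_NormedModule f z l -> cderiv f z l.
Proof.
  intros [_ Hf].
  specialize (Hf z (fun P HP => HP)).
  exists (fun w => if excluded_middle_informative (w = z) then l else ((f w - f z) / (w - z))%C).
  split; [destruct excluded_middle_informative; tauto |].
  split.
  - intros eps Heps.
    assert (He2 : 0 < eps / 2) by lra.
    specialize (Hf (mkposreal _ He2)).
    apply (@locally_le_locally_norm C_AbsRing (AbsRing_NormedModule C_AbsRing)) in Hf.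
    destruct Hf as [d Hd].
    exists d; split; [apply cond_pos |].
    intros w Hw.
    destruct (excluded_middle_informative (z = z)) as [_|N]; [| tauto].
    destruct (excluded_middle_informative (w = z)) as [E|N].
    + replace (l - l)%C with (RtoC 0) by ring; rewrite Cmod_0; exact Heps.
    + specialize (Hd w Hw); simpl in Hd.
      assert (Hd' : Cmod (f w - f z - (w - z) * l)%C <= eps / 2 * Cmod (w - z)%C) by exact Hd.
      assert (Hwz : (w - z)%C <> RtoC 0).
      { intros H; apply N; replace w with (z + (w - z))%C by ring; rewrite H; ring. }
      replace ((f w - f z) / (w - z) - l)%C with ((f w - f z - (w - z) * l) / (w - z))%C
        by (field; exact Hwz).
      rewrite Cmod_div by exact Hwz.
      apply Cmod_gt_0 in Hwz.
      apply Rle_lt_trans with (eps / 2); [| lra].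
      apply Rle_div_l; assumption.
  - exists 1; split; [lra |]; intros w _.
    destruct excluded_middle_informative as [E|N].
    + rewrite E; ring.
    + field; intros H; apply N; replace w with (z + (w - z))%C by ring; rewrite H; ring.
Qed.

(** The Cauchy-Riemann equations: the two gradients are the rows of the real matrix of
    multiplication by [l]. *)
Lemma cderiv_differentiable (f : C -> C) (z l : C) : cderiv f z l ->
  differentiable_pt_lim (fun x y => Re (f (x, y))) (Re z) (Im z) (Re l) (- Im l) /\
  differentiable_pt_lim (fun x y => Im (f (x, y))) (Re z) (Im z) (Im l) (Re l).
Proof.
  intros [phi [Hl [Hphi [d [Hd Hf]]]]].
  assert (Hmain : forall eps : posreal, locally_2d (fun x y =>
    Cmod (f (x, y) - f z - l * ((x, y) - z))%C <= eps * Rmax (Rabs (x - Re z)) (Rabs (y - Im z)))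
    (Re z) (Im z)).
  { intros eps.
    destruct (Hphi (eps / 2)) as [d1 [Hd1 H1]]; [apply is_pos_div_2 |].
    (* The modulus is at most the sum of the two coordinate distances, hence at most twice their
       maximum; this costs a factor 2 in the radius here and in [eps / 2] above. *)
    assert (Hdd : 0 < Rmin d d1 / 2) by (assert (H := Rmin_pos _ _ Hd Hd1); lra).
    exists (mkposreal _ Hdd); intros x y Hx Hy; simpl in Hx, Hy.
    assert (Hm : Cmod ((x, y) - z)%C <= Rabs (x - Re z) + Rabs (y - Im z)) by apply Cmod_le_abs.
    assert (Hm1 := Rmin_l d d1); assert (Hm2 := Rmin_r d d1).
    rewrite Hf by lra.
    replace (f z + phi (x, y) * ((x, y) - z) - f z - l * ((x, y) - z))%C
      with ((phi (x, y) - phi z) * ((x, y) - z))%C by (rewrite Hl; ring).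
    rewrite Cmod_mult.
    replace (eps * Rmax (Rabs (x - Re z)) (Rabs (y - Im z)))
      with (eps / 2 * (2 * Rmax (Rabs (x - Re z)) (Rabs (y - Im z)))) by field.
    assert (M1 := Rmax_l (Rabs (x - Re z)) (Rabs (y - Im z))).
    assert (M2 := Rmax_r (Rabs (x - Re z)) (Rabs (y - Im z))).
    apply Rmult_le_compat; try apply Cmod_ge_0; [| lra].
    left; apply H1; lra. }
  split; intros eps; destruct (Hmain eps) as [dd Hdd]; exists dd; intros x y Hx Hy;
    (eapply Rle_trans; [| apply (Hdd x y Hx Hy)]); destruct z as [x0 y0], l as [l1 l2].
  - eapply Rle_trans; [| apply re_le_Cmod]; right; apply f_equal; unfold Re, Im; simpl; ring.
  - eapply Rle_trans; [| apply im_le_Cmod]; right; apply f_equal; unfold Re, Im; simpl; ring.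
Qed.

Lemma differentiable_pt_lim_swap (f : R -> R -> R) (x y lx ly : R) :
  differentiable_pt_lim f x y lx ly -> differentiable_pt_lim (fun u v => f v u) y x ly lx.
Proof.
  intros H eps; destruct (H eps) as [d Hd]; exists d; intros u v Hu Hv.
  rewrite Rmax_comm, (Rplus_comm (ly * _)); apply Hd; assumption.
Qed.

Lemma differentiable_pt_lim_affine_mult (c x y : R) :
  differentiable_pt_lim (fun u v => c + u * v) x y y x.
Proof.
  intros eps; exists eps; intros u v Hu Hv.
  replace (c + u * v - (c + x * y) - (y * (u - x) + x * (v - y)))
    with ((u - x) * (v - y)) by ring.
  rewrite Rabs_mult; apply Rmult_le_compat; try apply Rabs_pos; [lra | apply Rmax_r].
Qed.

(** With [g] the cosine or the sine this covers both coordinates of a point at distance [exp s] from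
    a centre. *)
Lemma differentiable_pt_lim_polar (g : R -> R) (c s t g' : R) : derivable_pt_lim g t g' ->
  differentiable_pt_lim (fun s t => c + exp s * g t) s t (exp s * g t) (exp s * g').
Proof.
  intros Hg.
  assert (H := differentiable_pt_lim_comp (fun u v => c + u * v) (fun s _ => exp s) (fun _ t => g t)
    s t _ _ _ _ _ _ (differentiable_pt_lim_affine_mult c (exp s) (g t))
    (differentiable_pt_lim_proj1_0 exp s t _ (derivable_pt_lim_exp s))
    (differentiable_pt_lim_swap _ _ _ _ _ (differentiable_pt_lim_proj1_0 g t s g' Hg))).
  replace (exp s * g t) with (g t * exp s + exp s * 0) by ring.
  replace (exp s * g') with (g t * 0 + exp s * g') by ring.
  exact H.
Qed.

(** * Polar coordinates and circle means *)

Definition circ (z : C) (r t : R) : C := (Re z + r * cos t, Im z + r * sin t).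

Lemma Cmod_circ (z : C) (r t : R) : 0 <= r -> Cmod (circ z r t - z)%C = r.
Proof.
  intros Hr; apply Rsqr_inj; [apply Cmod_ge_0 | exact Hr |].
  rewrite !Rsqr_pow2, Cmod2_alt; destruct z as [x y]; simpl.
  assert (H := sin2_cos2 t); unfold Rsqr in H; nra.
Qed.

(** The map [s + i t] to [z + exp (s + i t)] is holomorphic, so a Cauchy-Riemann equation survives
    the change of variables. It appears as the repeated [A], the form that [goursat] takes. *)
Lemma polar_differentiable (f : C -> C) (z : C) (s t l1 l2 : R) :
  cderiv f (circ z (exp s) t) (l1, l2) ->
  exists A B D, differentiable_pt_lim (fun s t => Re (f (circ z (exp s) t))) s t A B /\
    differentiable_pt_lim (fun s t => Im (f (circ z (exp s) t))) s t D A.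
Proof.
  intros Hf; destruct (cderiv_differentiable _ _ _ Hf) as [HR HI]; simpl in HR, HI.
  assert (HX := differentiable_pt_lim_polar cos (Re z) s t _ (derivable_pt_lim_cos t)).
  assert (HY := differentiable_pt_lim_polar sin (Im z) s t _ (derivable_pt_lim_sin t)).
  assert (H1 := differentiable_pt_lim_comp _ _ _ s t _ _ _ _ _ _ HR HX HY).
  assert (H2 := differentiable_pt_lim_comp _ _ _ s t _ _ _ _ _ _ HI HX HY).
  eexists _, _, _; split; [exact H1 |].
  replace (l1 * (exp s * cos t) + - l2 * (exp s * sin t))
    with (l2 * (exp s * - sin t) + l1 * (exp s * cos t)) by ring.
  exact H2.
Qed.

Section MeanValue.
Variables (f : C -> C) (z : C) (d : R).
Hypotheses (Hc : ccont f z)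
  (Hf : forall w, 0 < Cmod (w - z)%C < d -> exists l, cderiv f w l).

Lemma polar_differentiable_in (s t : R) : exp s < d ->
  exists A B D, differentiable_pt_lim (fun s t => Re (f (circ z (exp s) t))) s t A B /\
    differentiable_pt_lim (fun s t => Im (f (circ z (exp s) t))) s t D A.
Proof.
  intros Hs; destruct (Hf (circ z (exp s) t)) as [[l1 l2] Hl].
  - rewrite Cmod_circ; [split; [apply exp_pos | exact Hs] | left; apply exp_pos].
  - exact (polar_differentiable f z s t l1 l2 Hl).
Qed.

Lemma polar_continuous_in (s t : R) : exp s < d ->
  continuity_2d_pt (fun s t => Re (f (circ z (exp s) t))) s t /\
  continuity_2d_pt (fun s t => Im (f (circ z (exp s) t))) s t.
Proof.
  intros Hs; destruct (polar_differentiable_in s t Hs) as [A [B [D [H1 H2]]]].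
  split; apply differentiable_continuity_pt; eexists _, _; eassumption.
Qed.

Lemma ex_RInt_circle (r : R) : 0 < r < d ->
  ex_RInt (fun t => Re (f (circ z r t))) 0 (2 * PI).
Proof.
  intros Hr; apply (ex_RInt_continuous (V := R_CompleteNormedModule)); intros t _.
  rewrite <- (exp_ln r) in * by lra.
  apply (continuity_2d_pt_slice2 (fun s t => Re (f (circ z (exp s) t)))).
  apply polar_continuous_in; lra.
Qed.

(** Zero flux through the rectangle with [s] from [ln r1] to [ln r2] and [t] from 0 to [2 * PI]: the
    sides [t = 0] and [t = 2 * PI] cancel by periodicity, and the other two are the circle
    integrals. *)
Lemma circle_integral_const (r1 r2 : R) : 0 < r1 < r2 -> r2 < d ->
  RInt (fun t => Re (f (circ z r1 t))) 0 (2 * PI) = RInt (fun t => Re (f (circ z r2 t))) 0 (2 * PI).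
Proof.
  intros H1 H2.
  set (u := fun s t => Re (f (circ z (exp s) t))).
  set (v := fun s t => Im (f (circ z (exp s) t))).
  assert (Hln := ln_increasing r1 r2 ltac:(lra) ltac:(lra)).
  assert (Hpi := PI_RGT_0).
  assert (Hexp : forall s, ln r1 <= s <= ln r1 + (ln r2 - ln r1) -> exp s < d).
  { intros s Hs; apply Rle_lt_trans with (exp (ln r2)); [| rewrite exp_ln; lra].
    destruct (Req_dec s (ln r2)) as [->|N]; [lra | left; apply exp_increasing; lra]. }
  assert (HG : flux u v (ln r1) 0 (ln r2 - ln r1) (2 * PI) = 0).
  { apply goursat; [| | lra | lra]; intros s t Hs Ht.
    - apply polar_continuous_in, Hexp, Hs.
    - apply polar_differentiable_in, Hexp, Hs. }
  unfold flux in HG.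
  rewrite (RInt_ext (fun s => v s (0 + 2 * PI) - v s 0) (fun _ => 0)) in HG.
  2:{ intros s _; unfold v, circ; rewrite Rplus_0_l, cos_2PI, sin_2PI, cos_0, sin_0; apply Rminus_diag. }
  rewrite RInt_const, Rplus_0_l in HG.
  replace (ln r1 + (ln r2 - ln r1)) with (ln r2) in HG by ring.
  assert (HE : RInt (fun t => u (ln r2) t - u (ln r1) t) 0 (2 * PI)
    = RInt (fun t => Re (f (circ z r2 t))) 0 (2 * PI) - RInt (fun t => Re (f (circ z r1 t))) 0 (2 * PI)).
  { unfold u; rewrite !exp_ln by lra.
    apply (RInt_minus (fun t => Re (f (circ z r2 t))) (fun t => Re (f (circ z r1 t))));
      apply ex_RInt_circle; lra. }
  rewrite HE in HG; unfold scal in HG; simpl in HG; unfold mult in HG; simpl in HG; lra.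
Qed.

(** The integral does not depend on the radius, and on a tiny circle continuity at the centre puts
    the integrand within [eps] of [Re (f z)]. *)
Lemma mean_value (r : R) : 0 < r < d ->
  RInt (fun t => Re (f (circ z r t))) 0 (2 * PI) = 2 * PI * Re (f z).
Proof.
  intros Hr; assert (Hpi := PI_RGT_0).
  set (I := RInt _ _ _).
  enough (Heps : forall eps, 0 < eps -> Rabs (I - 2 * PI * Re (f z)) <= 2 * PI * eps).
  { apply NNPP; intros Hne.
    assert (H : 0 < Rabs (I - 2 * PI * Re (f z))) by (apply Rabs_pos_lt; lra).
    specialize (Heps (Rabs (I - 2 * PI * Re (f z)) / (4 * PI)) ltac:(apply Rdiv_lt_0_compat; lra)).
    replace (2 * PI * (Rabs (I - 2 * PI * Re (f z)) / (4 * PI)))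
      with (Rabs (I - 2 * PI * Re (f z)) / 2) in Heps by (field; lra).
    lra. }
  intros eps Heps.
  destruct (Hc eps Heps) as [e [He Hce]].
  set (r1 := Rmin r e / 2).
  assert (Hr1 : 0 < r1 < r /\ r1 < e).
  { unfold r1; assert (H1 := Rmin_l r e); assert (H2 := Rmin_r r e).
    assert (H3 := Rmin_pos r e ltac:(lra) He); lra. }
  unfold I; rewrite <- (circle_integral_const r1 r) by lra.
  replace (2 * PI) with (0 + 2 * PI) at 1 by ring.
  apply RInt_near_const; [lra | rewrite Rplus_0_l; apply ex_RInt_circle; lra |].
  intros t _; left.
  eapply Rle_lt_trans; [| apply (Hce (circ z r1 t)); rewrite Cmod_circ; lra].
  eapply Rle_trans; [| apply re_le_Cmod]; right; f_equal.
Qed.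
End MeanValue.

(** * The maximum principle *)

Lemma Cmod_minus_sym (z w : C) : Cmod (z - w)%C = Cmod (w - z)%C.
Proof. rewrite <- Cmod_opp; f_equal; ring. Qed.

Lemma Cminus_neq_0 (z w : C) : z <> w -> (z - w)%C <> RtoC 0.
Proof. intros N H; apply N; replace z with (w + (z - w))%C by ring; rewrite H; ring. Qed.

Lemma Cmod_triangle_rev (z w : C) : Cmod z - Cmod w <= Cmod (z - w)%C.
Proof.
  assert (H := Cmod_triangle (z - w) w); replace (z - w + w)%C with z in H by ring; lra.
Qed.

Lemma ccont_const (c z : C) : ccont (fun _ => c) z.
Proof.
  intros eps Heps; exists 1; split; [lra |]; intros w _.
  replace (c - c)%C with (RtoC 0) by ring; rewrite Cmod_0; exact Heps.
Qed.

Lemma ccont_id (z : C) : ccont (fun w => w) z.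
Proof. intros eps Heps; exists eps; split; [exact Heps | auto]. Qed.

Lemma ccont_conj (z : C) : ccont Cconj z.
Proof.
  intros eps Heps; exists eps; split; [exact Heps |]; intros w Hw.
  rewrite <- Cminus_conj, Cmod_conj; exact Hw.
Qed.

Lemma ccont_comp_conj (f : C -> C) (z : C) : ccont f z -> ccont (fun w => Cconj (f w)) z.
Proof.
  intros H eps Heps; destruct (H eps Heps) as [d [Hd Hf]]; exists d; split; [exact Hd |].
  intros w Hw; rewrite <- Cminus_conj, Cmod_conj; auto.
Qed.

Lemma ccont_plus (f g : C -> C) (z : C) :
  ccont f z -> ccont g z -> ccont (fun w => (f w + g w)%C) z.
Proof.
  intros Hf Hg eps Heps.
  destruct (Hf (eps / 2) ltac:(lra)) as [d1 [Hd1 H1]].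
  destruct (Hg (eps / 2) ltac:(lra)) as [d2 [Hd2 H2]].
  exists (Rmin d1 d2); split; [apply Rmin_pos; assumption |]; intros w Hw.
  specialize (H1 w (Rlt_le_trans _ _ _ Hw (Rmin_l _ _))).
  specialize (H2 w (Rlt_le_trans _ _ _ Hw (Rmin_r _ _))).
  replace (f w + g w - (f z + g z))%C with ((f w - f z) + (g w - g z))%C by ring.
  eapply Rle_lt_trans; [apply Cmod_triangle | lra].
Qed.

Lemma ccont_mult (f g : C -> C) (z : C) :
  ccont f z -> ccont g z -> ccont (fun w => (f w * g w)%C) z.
Proof.
  intros Hf Hg eps Heps.
  set (K := 1 + Cmod (f z) + Cmod (g z)).
  assert (HF := Cmod_ge_0 (f z)); assert (HG := Cmod_ge_0 (g z)).
  assert (HK : 0 < K) by (unfold K; lra).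
  (* The error is at most [e * e + Cmod (f z) * e + e * Cmod (g z)]; since [e <= 1] this is at most
     [e * K], that is, at most [eps / 2]. *)
  set (e := Rmin 1 (eps / (2 * K))).
  assert (He : 0 < e) by (apply Rmin_pos; [lra | apply Rdiv_lt_0_compat; lra]).
  destruct (Hf e He) as [d1 [Hd1 H1]]; destruct (Hg e He) as [d2 [Hd2 H2]].
  exists (Rmin d1 d2); split; [apply Rmin_pos; assumption |]; intros w Hw.
  specialize (H1 w (Rlt_le_trans _ _ _ Hw (Rmin_l _ _))).
  specialize (H2 w (Rlt_le_trans _ _ _ Hw (Rmin_r _ _))).
  replace (f w * g w - f z * g z)%C
    with ((f w - f z) * (g w - g z) + (f z * (g w - g z) + (f w - f z) * g z))%C by ring.
  assert (HeK : e * K <= eps / 2).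
  { replace (eps / 2) with (eps / (2 * K) * K) by (field; lra).
    apply Rmult_le_compat_r; [lra | apply Rmin_r]. }
  assert (He1 : e <= 1) by apply Rmin_l.
  eapply Rle_lt_trans; [apply Cmod_triangle |].
  eapply Rle_lt_trans; [apply Rplus_le_compat_l, Cmod_triangle |].
  rewrite !Cmod_mult.
  assert (P1 := Cmod_ge_0 (f w - f z)%C); assert (P2 := Cmod_ge_0 (g w - g z)%C).
  assert (Q1 : Cmod (f w - f z)%C * Cmod (g w - g z)%C <= e * 1).
  { apply Rmult_le_compat; lra. }
  assert (Q2 : Cmod (f z) * Cmod (g w - g z)%C <= Cmod (f z) * e)
    by (apply Rmult_le_compat_l; lra).
  assert (Q3 : Cmod (f w - f z)%C * Cmod (g z) <= e * Cmod (g z))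
    by (apply Rmult_le_compat_r; lra).
  unfold K in HeK; lra.
Qed.

Lemma ccont_inv (f : C -> C) (z : C) :
  ccont f z -> f z <> RtoC 0 -> ccont (fun w => (/ f w)%C) z.
Proof.
  intros Hf Hz eps Heps.
  set (a := Cmod (f z)).
  assert (Ha : 0 < a) by (apply Cmod_gt_0, Hz).
  assert (Haa : 0 < eps * (a * a) / 2).
  { assert (0 < a * a) by (apply Rmult_lt_0_compat; exact Ha).
    assert (0 < eps * (a * a)) by (apply Rmult_lt_0_compat; assumption); lra. }
  (* The first bound keeps the modulus of [f w] above [a / 2]; the second compensates the resulting
     denominator [a / 2 * a]. *)
  destruct (Hf (Rmin (a / 2) (eps * (a * a) / 2))) as [d [Hd H]].
  { apply Rmin_pos; lra. }
  exists d; split; [exact Hd |]; intros w Hw; specialize (H w Hw).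
  assert (H1 := Rlt_le_trans _ _ _ H (Rmin_l _ _)).
  assert (H2 := Rlt_le_trans _ _ _ H (Rmin_r _ _)).
  assert (Hw2 : a / 2 < Cmod (f w)).
  { assert (T := Cmod_triangle_rev (f z) (f w)); rewrite Cmod_minus_sym in T; fold a in T; lra. }
  assert (Hw0 : f w <> RtoC 0) by (apply Cmod_gt_0; lra).
  replace (/ f w - / f z)%C with (- (f w - f z) / (f w * f z))%C by (field; auto).
  rewrite Cmod_div by (apply Cmult_neq_0; assumption).
  rewrite Cmod_opp, Cmod_mult; fold a.
  assert (Hpos : 0 < Cmod (f w) * a) by (apply Rmult_lt_0_compat; lra).
  apply Rlt_div_l; [exact Hpos |].
  eapply Rlt_le_trans; [exact H2 |].
  replace (eps * (a * a) / 2) with (eps * (a / 2 * a)) by field.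
  apply Rmult_le_compat_l; [lra |]; apply Rmult_le_compat_r; lra.
Qed.

Lemma ccont_ext_loc (f g : C -> C) (z : C) (d : R) : 0 < d ->
  (forall w, Cmod (w - z)%C < d -> f w = g w) -> ccont f z -> ccont g z.
Proof.
  intros Hd He Hf eps Heps; destruct (Hf eps Heps) as [e [Hpos H]].
  exists (Rmin d e); split; [apply Rmin_pos; assumption |]; intros w Hw.
  rewrite <- !He.
  - exact (H w (Rlt_le_trans _ _ _ Hw (Rmin_r _ _))).
  - replace (z - z)%C with (RtoC 0) by ring; rewrite Cmod_0; exact Hd.
  - exact (Rlt_le_trans _ _ _ Hw (Rmin_l _ _)).
Qed.

Lemma ccont_neq_0 (f : C -> C) (z : C) : ccont f z -> f z <> RtoC 0 ->
  exists d, 0 < d /\ forall w, Cmod (w - z)%C < d -> f w <> RtoC 0.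
Proof.
  intros Hf Hz; apply Cmod_gt_0 in Hz; destruct (Hf _ Hz) as [d [Hd H]].
  exists d; split; [exact Hd |]; intros w Hw E; specialize (H w Hw); rewrite E in H.
  replace (RtoC 0 - f z)%C with (- f z)%C in H by ring; rewrite Cmod_opp in H; lra.
Qed.

Lemma cderiv_const (c z : C) : cderiv (fun _ => c) z (RtoC 0).
Proof.
  exists (fun _ => RtoC 0); split; [reflexivity |]; split; [apply ccont_const |].
  exists 1; split; [lra |]; intros; ring.
Qed.

Lemma cderiv_id (z : C) : cderiv (fun w => w) z (RtoC 1).
Proof.
  exists (fun _ => RtoC 1); split; [reflexivity |]; split; [apply ccont_const |].
  exists 1; split; [lra |]; intros; ring.
Qed.

Lemma cderiv_plus (f g : C -> C) (z l m : C) :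
  cderiv f z l -> cderiv g z m -> cderiv (fun w => (f w + g w)%C) z (l + m)%C.
Proof.
  intros [phi [<- [Hp [d1 [Hd1 H1]]]]] [psi [<- [Hq [d2 [Hd2 H2]]]]].
  exists (fun w => (phi w + psi w)%C); split; [reflexivity |]; split; [apply ccont_plus; assumption |].
  exists (Rmin d1 d2); split; [apply Rmin_pos; assumption |]; intros w Hw.
  rewrite H1 by exact (Rlt_le_trans _ _ _ Hw (Rmin_l _ _)).
  rewrite H2 by exact (Rlt_le_trans _ _ _ Hw (Rmin_r _ _)); ring.
Qed.

Lemma cderiv_mult (f g : C -> C) (z l m : C) :
  cderiv f z l -> cderiv g z m -> cderiv (fun w => (f w * g w)%C) z (l * g z + f z * m)%C.
Proof.
  intros Hf Hg; assert (Hgc := cderiv_ccont _ _ _ Hg).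
  destruct Hf as [phi [<- [Hp [d1 [Hd1 H1]]]]], Hg as [psi [<- [Hq [d2 [Hd2 H2]]]]].
  exists (fun w => (phi w * g w + f z * psi w)%C); split; [reflexivity |]; split.
  - apply ccont_plus; apply ccont_mult; try assumption; apply ccont_const.
  - exists (Rmin d1 d2); split; [apply Rmin_pos; assumption |]; intros w Hw.
    rewrite H1 by exact (Rlt_le_trans _ _ _ Hw (Rmin_l _ _)).
    rewrite H2 by exact (Rlt_le_trans _ _ _ Hw (Rmin_r _ _)); ring.
Qed.

Lemma cderiv_inv (f : C -> C) (z l : C) :
  cderiv f z l -> f z <> RtoC 0 -> cderiv (fun w => (/ f w)%C) z (- l / (f z * f z))%C.
Proof.
  intros Hf Hz; assert (Hc := cderiv_ccont _ _ _ Hf).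
  destruct (ccont_neq_0 f z Hc Hz) as [d1 [Hd1 H1]].
  destruct Hf as [phi [<- [Hp [d [Hd H]]]]].
  (* The slope comes from [/ f w - / f z = - (f w - f z) / (f w * f z)]. *)
  exists (fun w => (- (1) * (phi w * (/ f w * / f z)))%C); split; [field; exact Hz |]; split.
  - apply ccont_mult; [apply ccont_const |]; apply ccont_mult; [exact Hp |].
    apply ccont_mult; [apply ccont_inv; assumption | apply ccont_const].
  - exists (Rmin d d1); split; [apply Rmin_pos; assumption |]; intros w Hw.
    specialize (H w (Rlt_le_trans _ _ _ Hw (Rmin_l _ _))).
    specialize (H1 w (Rlt_le_trans _ _ _ Hw (Rmin_r _ _))).
    replace (/ f w)%C with (/ f z - (f w - f z) * (/ f w * / f z))%C at 1 by (field; auto).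
    replace (f w - f z)%C with (phi w * (w - z))%C by (rewrite H; ring); ring.
Qed.

Lemma cderiv_ext_loc (f g : C -> C) (z l : C) (d : R) : 0 < d ->
  (forall w, Cmod (w - z)%C < d -> f w = g w) -> cderiv f z l -> cderiv g z l.
Proof.
  intros Hd He [phi [<- [Hp [e [Hpos H]]]]].
  exists phi; split; [reflexivity |]; split; [exact Hp |].
  exists (Rmin d e); split; [apply Rmin_pos; assumption |]; intros w Hw.
  rewrite <- !He.
  - exact (H w (Rlt_le_trans _ _ _ Hw (Rmin_r _ _))).
  - replace (z - z)%C with (RtoC 0) by ring; rewrite Cmod_0; exact Hd.
  - exact (Rlt_le_trans _ _ _ Hw (Rmin_l _ _)).
Qed.

(** Compactness by bisection. If no maximum exists, each point of the disc has a strictly larger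
    value elsewhere, which by continuity dominates a neighbourhood. Being dominated by one value
    taken in the disc passes from the quarters to the whole, so one value dominates the disc and is
    itself exceeded. *)
Lemma disc_max (h : C -> C) (s : R) : 0 < s -> (forall z, Cmod z <= s -> ccont h z) ->
  exists z, Cmod z <= s /\ forall w, Cmod w <= s -> Re (h w) <= Re (h z).
Proof.
  intros Hs Hc; apply NNPP; intros Hno.
  assert (Hup : forall z, Cmod z <= s -> exists w, Cmod w <= s /\ Re (h z) < Re (h w)).
  { intros z Hz; apply NNPP; intros Hn; apply Hno; exists z; split; [exact Hz |].
    intros w Hw; apply Rnot_lt_le; intros Hlt; apply Hn; exists w; auto. }
  assert (H0 : Cmod (RtoC 0) <= s) by (rewrite Cmod_0; lra).
  destruct (rect_induction (fun x y w k => exists q, Cmod q <= s /\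
    forall p, Cmod p <= s -> x <= Re p <= x + w -> y <= Im p <= y + k -> Re (h p) <= Re (h q))
    (- s) (- s) (2 * s) (2 * s)) as [q [Hq Hmax]]; try lra.
  - intros x y w k [q1 [Hq1 H1]] [q2 [Hq2 H2]] [q3 [Hq3 H3]] [q4 [Hq4 H4]].
    assert (Hbig : forall q q', Cmod q <= s -> Cmod q' <= s ->
      exists q'', Cmod q'' <= s /\ Re (h q) <= Re (h q'') /\ Re (h q') <= Re (h q'')).
    { intros q q' Hq Hq'; destruct (Rle_dec (Re (h q)) (Re (h q'))).
      - exists q'; lra.
      - exists q; lra. }
    destruct (Hbig q1 q2 Hq1 Hq2) as [q5 [Hq5 [B1 B2]]].
    destruct (Hbig q3 q4 Hq3 Hq4) as [q6 [Hq6 [B3 B4]]].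
    destruct (Hbig q5 q6 Hq5 Hq6) as [q [Hq [B5 B6]]].
    exists q; split; [exact Hq |]; intros p Hp Hx Hy.
    destruct (Rle_dec (Re p) (x + w / 2)), (Rle_dec (Im p) (y + k / 2)).
    + specialize (H1 p Hp); lra.
    + specialize (H3 p Hp); lra.
    + specialize (H2 p Hp); lra.
    + specialize (H4 p Hp); lra.
  - intros p q _ _.
    assert (Hclose : forall c x y w k (z : C), x <= p <= x + w -> y <= q <= y + k ->
      w < c / 2 -> k < c / 2 -> x <= Re z <= x + w -> y <= Im z <= y + k -> Cmod (z - (p, q))%C < c).
    { intros c x y w k z Hp Hq Hw Hk Hx Hy.
      eapply Rle_lt_trans; [apply Cmod_le_abs |].
      destruct z as [z1 z2]; simpl in *.
      assert (Rabs (z1 + - p) <= w) by (apply Rabs_le; lra).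
      assert (Rabs (z2 + - q) <= k) by (apply Rabs_le; lra).
      lra. }
    destruct (Rle_dec (Cmod (p, q)) s) as [Hin|Hout].
    + destruct (Hup _ Hin) as [z' [Hz' Hlt]].
      destruct (Hc _ Hin (Re (h z') - Re (h (p, q))) ltac:(lra)) as [d [Hd H]].
      exists (d / 2); split; [lra |]; intros x y n Hx Hy _ _ _ _ Hw Hk.
      exists z'; split; [exact Hz' |]; intros z Hz Hzx Hzy.
      specialize (H z (Hclose d _ _ _ _ z Hx Hy Hw Hk Hzx Hzy)).
      assert (HR := Rle_trans _ _ _ (Rle_abs _) (re_le_Cmod (h z - h (p, q))%C)).
      change (Re (h z) - Re (h (p, q)) <= Cmod (h z - h (p, q))%C) in HR; lra.
    (* A small rectangle around a point outside the closed disc misses the disc, so the witness 0 is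
       arbitrary. *)
    + exists ((Cmod (p, q) - s) / 2); split; [lra |]; intros x y n Hx Hy _ _ _ _ Hw Hk.
      exists (RtoC 0); split; [exact H0 |]; intros z Hz Hzx Hzy.
      assert (HC := Hclose _ _ _ _ _ z Hx Hy Hw Hk Hzx Hzy).
      rewrite Cmod_minus_sym in HC.
      assert (T := Cmod_triangle_rev (p, q) z); lra.
  - destruct (Hup q Hq) as [q' [Hq' Hlt]].
    assert (A1 := re_le_Cmod q'); assert (A2 := im_le_Cmod q').
    apply Rabs_le_between in A1, A2.
    specialize (Hmax q' Hq' ltac:(lra) ltac:(lra)); lra.
Qed.

Section MaxModulus.
Variables (f : C -> C) (p q : C) (s B : R).
Hypotheses (Hs : 0 < s < 1) (HB : 0 <= B)
  (Hcont : forall z, Cmod z < 1 -> ccont f z)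
  (Hder : forall z, Cmod z < 1 -> z <> p -> z <> q -> exists l, cderiv f z l)
  (Hcirc : forall z, Cmod z = s -> Cmod (f z) <= B).

Lemma punctured_disc (z : C) : exists d, 0 < d /\
  forall w, 0 < Cmod (w - z)%C < d -> w <> p /\ w <> q.
Proof.
  assert (Hone : forall a : C, exists d, 0 < d /\ forall w, 0 < Cmod (w - z)%C < d -> w <> a).
  { intros a; destruct (excluded_middle_informative (a = z)) as [->|N].
    - exists 1; split; [lra |]; intros w Hw ->.
      replace (z - z)%C with (RtoC 0) in Hw by ring; rewrite Cmod_0 in Hw; lra.
    - exists (Cmod (a - z)%C); split; [apply Cmod_gt_0, Cminus_neq_0, N |].
      intros w Hw ->; lra. }
  destruct (Hone p) as [d1 [Hd1 H1]]; destruct (Hone q) as [d2 [Hd2 H2]].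
  exists (Rmin d1 d2); split; [apply Rmin_pos; assumption |]; intros w Hw.
  assert (M1 := Rmin_l d1 d2); assert (M2 := Rmin_r d1 d2).
  split; [apply H1 | apply H2]; lra.
Qed.

(* The term [e |z|^2] makes the mean value of the majorant over small circles exceed its value at the
   centre by [e r^2], so that it has no interior maximum. *)
Lemma max_modulus (z : C) : Cmod z <= s -> Cmod (f z) <= B.
Proof.
  intros Hz; apply Rnot_lt_le; intros Hlt.
  (* Half of the gap: since [s < 1], on the circle the majorant stays below [B ^ 2 + e], which is
     less than its value at [z]. Its maximum is therefore inside the disc. *)
  set (e := (Cmod (f z) ^ 2 - B ^ 2) / 2).
  assert (He : 0 < e) by (unfold e; nra).
  (* A complex expression with real values, so that the continuity rules and [disc_max] apply. *)
  set (U := fun w => (f w * Cconj (f w) + RtoC e * (w * Cconj w))%C).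
  assert (HU : forall w, Re (U w) = Cmod (f w) ^ 2 + e * Cmod w ^ 2).
  { intros w; unfold U; rewrite <- !Cmod2_conj, <- RtoC_mult, <- RtoC_plus; reflexivity. }
  destruct (disc_max U s) as [z0 [Hz0 Hmax]]; [lra | |].
  { intros w Hw; apply ccont_plus; apply ccont_mult.
    - apply Hcont; lra.
    - apply ccont_comp_conj, Hcont; lra.
    - apply ccont_const.
    - apply ccont_mult; [apply ccont_id | apply ccont_conj]. }
  assert (Hin : Cmod z0 < s).
  { destruct Hz0 as [H|H]; [exact H | exfalso].
    specialize (Hmax z Hz); rewrite !HU, H in Hmax; specialize (Hcirc z0 H).
    assert (0 <= Cmod (f z0)) by apply Cmod_ge_0.
    assert (Cmod (f z0) ^ 2 <= B ^ 2) by (apply pow_incr; lra).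
    assert (0 <= Cmod z ^ 2) by apply pow2_ge_0.
    assert (e * s ^ 2 < e * 1) by (apply Rmult_lt_compat_l; nra).
    assert (0 <= e * Cmod z ^ 2) by nra.
    unfold e in *; lra. }
  destruct (punctured_disc z0) as [d [Hd Hpq]].
  (* A holomorphic substitute for the majorant. Expanding the squared moduli of [f w - f z0] and
     [w - z0] shows that on the circle of radius [r] about [z0], [Re (U w)] is at least [Re (h w) -
     Re (h z0) + Re (U z0) + e * r ^ 2]. Maximality at [z0] then gives
     [Re (h w) <= Re (h z0) - e * r ^ 2], contradicting the mean value property of [h]. *)
  set (h := fun w => (RtoC 2 * Cconj (f z0) * f w + RtoC (2 * e) * Cconj z0 * (w + - z0))%C).
  set (d' := Rmin d (s - Cmod z0)).
  assert (Hd' : 0 < d') by (apply Rmin_pos; lra).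
  assert (M1 : d' <= d) by apply Rmin_l; assert (M2 : d' <= s - Cmod z0) by apply Rmin_r.
  assert (Hh : forall w, 0 < Cmod (w - z0)%C < d' -> exists l, cderiv h w l).
  { intros w Hw; destruct (Hpq w ltac:(lra)) as [N1 N2].
    assert (T := Cmod_triangle_rev w z0).
    destruct (Hder w ltac:(lra) N1 N2) as [l Hl].
    eexists; apply cderiv_plus; apply cderiv_mult.
    - apply cderiv_const.
    - exact Hl.
    - apply cderiv_const.
    - apply cderiv_plus; [apply cderiv_id | apply cderiv_const]. }
  assert (Hhc : ccont h z0).
  { apply ccont_plus; apply ccont_mult; try apply ccont_const.
    - apply Hcont; lra.
    - apply ccont_plus; [apply ccont_id | apply ccont_const]. }
  set (r := d' / 2).
  assert (Hmv := mean_value h z0 d' Hhc Hh r ltac:(unfold r; lra)).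
  assert (Hex := ex_RInt_circle h z0 d' Hh r ltac:(unfold r; lra)).
  assert (Hh0 : Re (h z0) = 2 * Cmod (f z0) ^ 2).
  { rewrite Cmod2_alt; unfold h; destruct (f z0), z0; simpl; ring. }
  assert (Hpi := PI_RGT_0).
  assert (Hle : RInt (fun t => Re (h (circ z0 r t))) 0 (2 * PI)
    <= RInt (fun _ => Re (h z0) - e * r ^ 2) 0 (2 * PI)).
  { apply RInt_le; [lra | exact Hex | apply ex_RInt_const |]; intros t _.
    assert (HC : Cmod (circ z0 r t - z0)%C = r) by (apply Cmod_circ; unfold r; lra).
    set (w := circ z0 r t) in *.
    assert (T := Cmod_triangle_rev w z0).
    specialize (Hmax w ltac:(unfold r in HC; lra)); rewrite !HU, !Cmod2_alt in Hmax.
    assert (HC2 : Cmod (w - z0)%C ^ 2 = r ^ 2) by (rewrite HC; reflexivity).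
    rewrite Hh0, Cmod2_alt; rewrite Cmod2_alt in HC2; unfold h.
    clearbody w; clear - Hmax HC2 He; destruct (f w) as [x1 y1], (f z0) as [x0 y0], w as [a b], z0 as [a0 b0].
    simpl in *; rewrite !Rmult_1_r in *.
    assert (0 <= (x1 - x0) ^ 2) by apply pow2_ge_0; assert (0 <= (y1 - y0) ^ 2) by apply pow2_ge_0.
    assert (HE : e * (r * r) = e * ((a - a0) ^ 2 + (b - b0) ^ 2)) by (rewrite <- HC2; ring).
    simpl in *. nra. }
  rewrite Hmv, RInt_const in Hle; unfold scal in Hle; simpl in Hle; unfold mult in Hle; simpl in Hle.
  assert (0 < PI * (e * (r * r))).
  { assert (0 < r) by (unfold r; lra).
    assert (0 < e * (r * r)) by (apply Rmult_lt_0_compat; [exact He | apply Rmult_lt_0_compat; lra]).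
    apply Rmult_lt_0_compat; assumption. }
  nra.
Qed.
End MaxModulus.

(** * The Schwarz-Pick inequalities *)

Definition dslope (f : C -> C) (a l w : C) : C :=
  if excluded_middle_informative (w = a) then l else ((f w - f a) / (w - a))%C.

Lemma dslope_at (f : C -> C) (a l : C) : dslope f a l a = l.
Proof. unfold dslope; destruct excluded_middle_informative; tauto. Qed.

Lemma dslope_neq (f : C -> C) (a l w : C) : w <> a -> dslope f a l w = ((f w - f a) / (w - a))%C.
Proof. intros N; unfold dslope; destruct excluded_middle_informative; tauto. Qed.

Lemma dslope_ccont_at (f : C -> C) (a l : C) : cderiv f a l -> ccont (dslope f a l) a.
Proof.
  intros [phi [<- [Hc [d [Hd H]]]]].
  apply ccont_ext_loc with phi d; [exact Hd | | exact Hc]; intros w Hw.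
  destruct (excluded_middle_informative (w = a)) as [->|N].
  - rewrite dslope_at; reflexivity.
  - rewrite dslope_neq, H by assumption; field; apply Cminus_neq_0, N.
Qed.

(** Near a point other than [a] the case distinction disappears, leaving a formula to which the
    product and inverse rules apply. *)
Lemma dslope_ext_loc (f : C -> C) (a l z : C) : z <> a ->
  forall w, Cmod (w - z)%C < Cmod (z - a)%C ->
    ((f w + - f a) * / (w + - a))%C = dslope f a l w.
Proof.
  intros N w Hw; rewrite dslope_neq; [reflexivity |].
  intros ->; rewrite Cmod_minus_sym in Hw; lra.
Qed.

Lemma dslope_ccont (f : C -> C) (a l z : C) : ccont f z -> z <> a -> ccont (dslope f a l) z.
Proof.
  intros Hf N; assert (Hza := Cminus_neq_0 z a N).
  apply ccont_ext_loc with (fun w => ((f w + - f a) * / (w + - a))%C) (Cmod (z - a)%C);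
    [apply Cmod_gt_0, Hza | apply dslope_ext_loc, N |].
  apply ccont_mult; [| apply ccont_inv; [| exact Hza]]; apply ccont_plus;
    try apply ccont_const; [exact Hf | apply ccont_id].
Qed.

Lemma dslope_cderiv (f : C -> C) (a l z m : C) : cderiv f z m -> z <> a ->
  cderiv (dslope f a l) z ((m - dslope f a l z) / (z - a))%C.
Proof.
  intros Hf N; assert (Hza := Cminus_neq_0 z a N).
  apply cderiv_ext_loc with (fun w => ((f w + - f a) * / (w + - a))%C) (Cmod (z - a)%C);
    [apply Cmod_gt_0, Hza | apply dslope_ext_loc, N |].
  rewrite dslope_neq by exact N.
  replace ((m - (f z - f a) / (z - a)) / (z - a))%C
    with ((m + 0) * / (z + - a) + (f z + - f a) * (- (1 + 0) / ((z + - a) * (z + - a))))%C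
    by (field; exact Hza).
  apply (cderiv_mult (fun w => (f w + - f a)%C) (fun w => (/ (w + - a))%C)).
  - apply cderiv_plus; [exact Hf | apply cderiv_const].
  - apply (cderiv_inv (fun w => (w + - a)%C)); [| exact Hza].
    apply cderiv_plus; [apply cderiv_id | apply cderiv_const].
Qed.

(** Carries estimates proved on discs of radius [s < 1] over to the unit disc. *)
Lemma left_limit_le (phi : R -> R) (s0 c : R) : s0 < 1 -> continuity_pt phi 1 ->
  (forall s, s0 < s < 1 -> phi s <= c) -> phi 1 <= c.
Proof.
  intros H0 Hphi H; apply Rnot_lt_le; intros Hlt.
  destruct (Hphi (phi 1 - c) ltac:(lra)) as [d [Hd Hs]].
  set (s := 1 - Rmin d (1 - s0) / 2).
  assert (Hm := Rmin_pos d (1 - s0) ltac:(lra) ltac:(lra)).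
  assert (M1 := Rmin_l d (1 - s0)); assert (M2 := Rmin_r d (1 - s0)).
  specialize (H s ltac:(unfold s; lra)).
  assert (HD : Rabs (phi s - phi 1) < phi 1 - c).
  { apply (Hs s); split; [split; [exact Logic.I | unfold s; lra] |].
    simpl; unfold Rdist; rewrite Rabs_left; unfold s; lra. }
  apply Rabs_def2 in HD; lra.
Qed.

(** On this circle [s ^ 2] is [z * Cconj z], so the left factor is [z * Cconj (z - a)]. *)
Lemma Cmod_circle_reflection (a z : C) (s : R) : 0 <= s -> Cmod z = s ->
  Cmod (RtoC (s ^ 2) - Cconj a * z)%C = s * Cmod (z - a)%C.
Proof.
  intros Hs Hz; rewrite <- (Cmod_conj (z - a)), <- Hz, <- Cmod_mult.
  rewrite Cmod2_conj, Cminus_conj; f_equal; ring.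
Qed.

(** For [x] and [y] in the unit disc the right side is nonnegative, so the quotient of [x - y] by
    [1 - Cconj y * x] has modulus at most 1. *)
Lemma Cmod_mobius_id (x y : C) :
  Cmod (1 - Cconj y * x)%C ^ 2 - Cmod (x - y)%C ^ 2 = (1 - Cmod x ^ 2) * (1 - Cmod y ^ 2).
Proof. rewrite !Cmod2_alt; destruct x, y; simpl; ring. Qed.

Section SchwarzPick.
Variables (g : C -> C) (q : R) (a l : C).
Hypotheses (Hq : q < 1)
  (Hcont : forall z, Cmod z < 1 -> ccont g z)
  (Hder : forall z, Cmod z < 1 -> z <> RtoC 0 -> exists m, cderiv g z m)
  (Hbd : forall z, Cmod z < 1 -> Cmod (g z) <= q)
  (Ha : 0 < Cmod a < 1) (Hl : cderiv g a l).

(* For [g a = 0] this is the Blaschke factor argument on the disc of radius [s]: the factor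
   [(s^2 - conj a w) / (s (w - a))] is unimodular on [|w| = s], and the pole at [a] is removed. *)
Let D (w : C) : C := (1 + - Cconj (g a) * g w)%C.
Let Q (s : R) (w : C) : C :=
  (dslope g a l w * / D w * (RtoC (/ s) * (RtoC (s ^ 2) + - Cconj a * w)))%C.

Lemma pick_denom_neq_0 (w : C) : Cmod w < 1 -> D w <> RtoC 0.
Proof.
  intros Hw; apply Cmod_gt_0.
  assert (H := Cmod_triangle_rev (RtoC 1) (Cconj (g a) * g w)%C).
  rewrite Cmod_mult, Cmod_conj, Cmod_1 in H.
  replace (D w) with (1 - Cconj (g a) * g w)%C by (unfold D; ring).
  assert (H1 := Hbd a (proj2 Ha)); assert (H2 := Hbd w Hw).
  assert (P1 := Cmod_ge_0 (g a)); assert (P2 := Cmod_ge_0 (g w)); nra.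
Qed.

Lemma pick_quotient_ccont (s : R) (w : C) : Cmod w < 1 -> ccont (Q s) w.
Proof.
  intros Hw; apply ccont_mult; [apply ccont_mult |].
  - destruct (excluded_middle_informative (w = a)) as [->|N].
    + apply dslope_ccont_at, Hl.
    + apply dslope_ccont; [apply Hcont, Hw | exact N].
  - apply ccont_inv; [| apply pick_denom_neq_0, Hw].
    apply ccont_plus; [apply ccont_const |].
    apply ccont_mult; [apply ccont_const | apply Hcont, Hw].
  - apply ccont_mult; [apply ccont_const |]; apply ccont_plus; [apply ccont_const |].
    apply ccont_mult; [apply ccont_const | apply ccont_id].
Qed.

Lemma pick_quotient_cderiv (s : R) (w : C) : Cmod w < 1 -> w <> RtoC 0 -> w <> a ->
  exists m, cderiv (Q s) w m.
Proof.
  intros Hw N0 Na; destruct (Hder w Hw N0) as [m Hm].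
  eexists; apply cderiv_mult; [apply cderiv_mult |].
  - apply dslope_cderiv; [exact Hm | exact Na].
  - apply cderiv_inv; [| apply pick_denom_neq_0, Hw].
    apply cderiv_plus; [apply cderiv_const |].
    apply cderiv_mult; [apply cderiv_const | exact Hm].
  - apply cderiv_mult; [apply cderiv_const |]; apply cderiv_plus; [apply cderiv_const |].
    apply cderiv_mult; [apply cderiv_const | apply cderiv_id].
Qed.

(** Maximum principle with exceptional points 0 and [a]. On the boundary circle the Blaschke factor
    is unimodular by [Cmod_circle_reflection], and the remaining quotient is bounded by
    [Cmod_mobius_id]. *)
Lemma pick_quotient_le (s : R) (w : C) : Cmod a < s < 1 -> Cmod w <= s -> Cmod (Q s w) <= 1.
Proof.
  intros Hs; apply (max_modulus (Q s) (RtoC 0) a); try lra.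
  - intros z Hz; apply pick_quotient_ccont, Hz.
  - intros z Hz N0 Na; apply pick_quotient_cderiv; assumption.
  - intros z Hz.
    assert (Hza : z <> a) by (intros ->; lra).
    assert (Hza0 := Cminus_neq_0 z a Hza).
    assert (HD := pick_denom_neq_0 z ltac:(lra)).
    assert (Hs0 : RtoC s <> RtoC 0) by (intros E; apply RtoC_inj in E; lra).
    assert (HQ : Q s z = ((g z - g a) / D z * ((RtoC (s ^ 2) - Cconj a * z) / (s * (z - a))))%C).
    { unfold Q; rewrite dslope_neq by exact Hza; rewrite RtoC_inv by lra; field; auto. }
    rewrite HQ, Cmod_mult, !Cmod_div, Cmod_circle_reflection, Cmod_mult, Cmod_R, (Rabs_pos_eq s)
      by (try apply Cmult_neq_0; assumption || lra).
    apply Cmod_gt_0 in Hza0, HD.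
    replace (s * Cmod (z - a)%C / (s * Cmod (z - a)%C)) with 1 by (field; lra).
    rewrite Rmult_1_r; apply Rle_div_l; [exact HD |].
    assert (Hid := Cmod_mobius_id (g z) (g a)).
    replace (1 - Cconj (g a) * g z)%C with (D z) in Hid by (unfold D; ring).
    assert (B1 := Hbd z ltac:(lra)); assert (B2 := Hbd a ltac:(lra)).
    assert (P1 := Cmod_ge_0 (g z)); assert (P2 := Cmod_ge_0 (g a)).
    assert (0 <= (1 - Cmod (g z) ^ 2) * (1 - Cmod (g a) ^ 2)) by (apply Rmult_le_pos; nra).
    rewrite Rmult_1_l; apply Rsqr_incr_0; [rewrite !Rsqr_pow2; lra | apply Cmod_ge_0 | lra].
Qed.

(** The bound on [Q s] at the origin, in the limit [s -> 1]. *)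
Lemma schwarz_pick_origin : Cmod (g (RtoC 0) - g a)%C <= Cmod a * Cmod (1 - Cconj (g a) * g (RtoC 0))%C.
Proof.
  (* The factor 1 exhibits the left side as the value at [s = 1] of a function of [s]. *)
  replace (Cmod (g (RtoC 0) - g a)%C) with (Cmod (g (RtoC 0) - g a)%C * 1) by ring.
  apply (left_limit_le (fun s => Cmod (g (RtoC 0) - g a)%C * s) (Cmod a)); [lra | reg |]; intros s Hs.
  assert (H := pick_quotient_le s (RtoC 0) Hs ltac:(rewrite Cmod_0; lra)).
  assert (Ha0 : a <> RtoC 0) by (apply Cmod_gt_0; lra).
  assert (HD := pick_denom_neq_0 (RtoC 0) ltac:(rewrite Cmod_0; lra)).
  assert (Hs0 : RtoC s <> RtoC 0) by (intros E; apply RtoC_inj in E; lra).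
  assert (HQ : Q s (RtoC 0) = ((g (RtoC 0) - g a) / (- a) * (s / D (RtoC 0)))%C).
  { unfold Q; rewrite dslope_neq by auto; rewrite RtoC_inv, RtoC_pow by lra; field; auto. }
  rewrite HQ, Cmod_mult, !Cmod_div, Cmod_opp, Cmod_R, Rabs_pos_eq in H;
    try assumption; try lra; [| intros E; apply Ha0; replace a with (- - a)%C by ring; rewrite E; ring].
  replace (1 - Cconj (g a) * g (RtoC 0))%C with (D (RtoC 0)) by (unfold D; ring).
  apply Cmod_gt_0 in HD.
  replace (Cmod (g (RtoC 0) - g a)%C / Cmod a * (s / Cmod (D (RtoC 0))))
    with (Cmod (g (RtoC 0) - g a)%C * s / (Cmod a * Cmod (D (RtoC 0)))) in H by (field; lra).
  apply Rle_div_l in H; [lra | apply Rmult_lt_0_compat; lra].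
Qed.

(** The bound on [Q s] at [a] itself, where the difference quotient takes the value [l], in the
    limit [s -> 1]. *)
Lemma schwarz_pick_deriv : Cmod l * (1 - Cmod a ^ 2) <= 1 - Cmod (g a) ^ 2.
Proof.
  assert (B := Hbd a (proj2 Ha)); assert (P := Cmod_ge_0 (g a)).
  replace (Cmod l * (1 - Cmod a ^ 2))
    with (Cmod l * (1 ^ 2 - Cmod a ^ 2)) by ring.
  apply (left_limit_le (fun s => Cmod l * (s ^ 2 - Cmod a ^ 2)) (Cmod a)); [lra | reg |]; intros s Hs.
  assert (H := pick_quotient_le s a Hs ltac:(lra)).
  assert (HDa : D a = RtoC (1 - Cmod (g a) ^ 2)).
  { unfold D; rewrite RtoC_minus, Cmod2_conj; ring. }
  assert (HQ : Q s a = (l * RtoC (/ (1 - Cmod (g a) ^ 2)) * (RtoC (/ s) * RtoC (s ^ 2 - Cmod a ^ 2)))%C).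
  { unfold Q; rewrite dslope_at, HDa, <- RtoC_inv by nra.
    rewrite (RtoC_minus (s ^ 2)), (Cmod2_conj a); ring. }
  assert (0 < s ^ 2 - Cmod a ^ 2) by nra.
  assert (0 < 1 - Cmod (g a) ^ 2) by nra.
  assert (0 < / (1 - Cmod (g a) ^ 2)) by (apply Rinv_0_lt_compat; assumption).
  assert (0 < / s) by (apply Rinv_0_lt_compat; lra).
  rewrite HQ, !Cmod_mult, !Cmod_R, !Rabs_pos_eq in H by lra.
  replace (Cmod l * / (1 - Cmod (g a) ^ 2) * (/ s * (s ^ 2 - Cmod a ^ 2)))
    with (Cmod l * (s ^ 2 - Cmod a ^ 2) / (s * (1 - Cmod (g a) ^ 2))) in H by (field; lra).
  apply Rle_div_l in H; [nra | apply Rmult_lt_0_compat; lra].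
Qed.
End SchwarzPick.

(** * Growth of bounded normalized functions *)

Section BoundedNormalized.
Variables (f f' : C -> C) (M : R).
Hypotheses (HM : 0 < M) (Hf : forall z, Cmod z < 1 -> cderiv f z (f' z))
  (Hf0 : f (RtoC 0) = RtoC 0) (Hf1 : cderiv f (RtoC 0) (RtoC 1))
  (Hbd : forall z, Cmod z < 1 -> Cmod (f z) <= M).

Section Scaled.
Variable N : R.
Hypothesis HN : M < N.

(** This is [f z / (N z)] with its singularity removed. Taking [N] strictly above [M] gives the
    bound [M / N < 1] required for Schwarz-Pick; [growth] later lets [N] tend to [M]. *)
Let g (z : C) : C := (dslope f (RtoC 0) (RtoC 1) z * RtoC (/ N))%C.

Lemma scaled_slope_mult (z : C) : (RtoC N * (z * g z))%C = f z.
Proof.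
  assert (HN0 : RtoC N <> RtoC 0) by (intros E; apply RtoC_inj in E; lra).
  unfold g; rewrite RtoC_inv by lra.
  destruct (excluded_middle_informative (z = RtoC 0)) as [->|Nz].
  - rewrite Hf0; ring.
  - rewrite dslope_neq, Hf0 by exact Nz; field; auto.
Qed.

Lemma scaled_slope_0 : g (RtoC 0) = RtoC (/ N).
Proof. unfold g; rewrite dslope_at; ring. Qed.

Lemma scaled_slope_ccont (z : C) : Cmod z < 1 -> ccont g z.
Proof.
  intros Hz; apply ccont_mult; [| apply ccont_const].
  destruct (excluded_middle_informative (z = RtoC 0)) as [->|Nz].
  - apply dslope_ccont_at, Hf1.
  - apply dslope_ccont; [eapply cderiv_ccont, Hf, Hz | exact Nz].
Qed.

(** The identity converts a bound on the derivative of [g] into one on [z * f' z - f z]. *)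
Lemma scaled_slope_cderiv (z : C) : Cmod z < 1 -> z <> RtoC 0 ->
  exists l, cderiv g z l /\ (RtoC N * (z * (z * l)))%C = (z * f' z - f z)%C.
Proof.
  intros Hz Nz.
  assert (HN0 : RtoC N <> RtoC 0) by (intros E; apply RtoC_inj in E; lra).
  eexists; split.
  - apply cderiv_mult; [apply dslope_cderiv; [apply Hf, Hz | exact Nz] | apply cderiv_const].
  - rewrite dslope_neq, Hf0, RtoC_inv by (exact Nz || lra).
    field; auto.
Qed.

(** Schwarz's lemma: on the circle of radius [s] the bound is [M / N / s]; the maximum principle
    carries it inside, and [s] tends to 1. Both exceptional points are the origin. *)
Lemma scaled_slope_le (z : C) : Cmod z < 1 -> Cmod (g z) <= M / N.
Proof.
  intros Hz; assert (P := Cmod_ge_0 z).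
  replace (Cmod (g z)) with (Cmod (g z) * 1) by ring.
  apply (left_limit_le (fun s => Cmod (g z) * s) (Cmod z)); [exact Hz | reg |]; intros s Hs.
  assert (HMN : 0 < M / N) by (apply Rdiv_lt_0_compat; lra).
  enough (Cmod (g z) <= M / N / s) by (apply Rle_div_r; lra).
  apply (max_modulus g (RtoC 0) (RtoC 0) s); try lra.
  - left; apply Rdiv_lt_0_compat; lra.
  - apply scaled_slope_ccont.
  - intros w Hw Nw _; destruct (scaled_slope_cderiv w Hw Nw) as [l [Hl _]]; eauto.
  - intros w Hw; specialize (Hbd w ltac:(lra)).
    rewrite <- scaled_slope_mult, (Cmod_mult (RtoC N)), (Cmod_mult w), Cmod_R, Rabs_pos_eq, Hw in Hbd by lra.
    replace (M / N / s) with (M / (s * N)) by (field; lra).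
    apply Rle_div_r; [apply Rmult_lt_0_compat; lra | lra].
Qed.

(** Compare [g 0 = / N] with the bound [M / N]. *)
Lemma one_le_bound : 1 <= M.
Proof.
  assert (H := scaled_slope_le (RtoC 0) ltac:(rewrite Cmod_0; lra)).
  assert (HI : 0 < / N) by (apply Rinv_0_lt_compat; lra).
  rewrite scaled_slope_0, Cmod_R, Rabs_pos_eq in H by lra.
  unfold Rdiv in H; nra.
Qed.

(** Both quantities are multiples of data of [g]: [f a - a] is [N * a * (g a - / N)], and
    [a * f' a - f a] is [N * a ^ 2] times the derivative of [g]. The two Schwarz-Pick inequalities
    bound these in terms of [g 0 = / N], and [N - / N] is [N * (1 - c ^ 2)] for [c = / N]. *)
Lemma scaled_growth (a : C) : 0 < Cmod a < 1 ->
  Cmod (f a - a)%C * (1 - Cmod a) <= (N - / N) * Cmod a ^ 2 /\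
  Cmod (a * f' a - f a)%C * (1 - Cmod a) ^ 2 <= (N - / N) * Cmod a ^ 2.
Proof.
  intros Ha.
  assert (Na : a <> RtoC 0) by (apply Cmod_gt_0; lra).
  destruct (scaled_slope_cderiv a (proj2 Ha) Na) as [l [Hl Hlf]].
  assert (HMN : M / N < 1) by (apply Rlt_div_l; lra).
  assert (Hder : forall z, Cmod z < 1 -> z <> RtoC 0 -> exists m, cderiv g z m).
  { intros z Hz Nz; destruct (scaled_slope_cderiv z Hz Nz) as [m [Hm _]]; eauto. }
  assert (S1 := schwarz_pick_origin g _ a l HMN scaled_slope_ccont Hder scaled_slope_le Ha Hl).
  assert (S2 := schwarz_pick_deriv g _ a l HMN scaled_slope_ccont Hder scaled_slope_le Ha Hl).
  assert (B0 := scaled_slope_le (RtoC 0) ltac:(rewrite Cmod_0; lra)).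
  assert (Bw := scaled_slope_le a ltac:(lra)).
  rewrite scaled_slope_0 in S1, B0.
  assert (Hc : 0 < / N) by (apply Rinv_0_lt_compat; lra).
  rewrite Cmod_R, Rabs_pos_eq in B0 by lra.
  set (c := / N) in *; set (w := g a) in *; set (r := Cmod a) in *.
  set (e := Cmod (RtoC c - w)%C) in *.
  assert (He : 0 <= e) by apply Cmod_ge_0.
  assert (Hc2 : 0 <= 1 - c ^ 2) by nra.
  assert (T1 : Cmod (1 - Cconj w * RtoC c)%C <= (1 - c ^ 2) + c * e).
  { replace (1 - Cconj w * RtoC c)%C with (RtoC (1 - c ^ 2) + RtoC c * Cconj (RtoC c - w))%C.
    - eapply Rle_trans; [apply Cmod_triangle |].
      rewrite Cmod_mult, Cmod_conj, !Cmod_R, !Rabs_pos_eq by lra; apply Rle_refl.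
    - destruct w; apply injective_projections; simpl; ring. }
  (* [S1] and [T1] give [e <= r * (1 - c ^ 2) + r * c * e]; as [c <= 1], the last term is absorbed
     on the left. *)
  assert (T2 : e * (1 - r) <= r * (1 - c ^ 2)).
  { assert (r * Cmod (1 - Cconj w * RtoC c)%C <= r * ((1 - c ^ 2) + c * e))
      by (apply Rmult_le_compat_l; lra).
    assert (e * (r * c) <= e * (r * 1)) by (apply Rmult_le_compat_l; [lra |]; nra).
    nra. }
  assert (T3 : c - Cmod w <= e).
  { assert (T := Cmod_triangle_rev (RtoC c) w).
    rewrite Cmod_R, Rabs_pos_eq in T by lra; exact T. }
  assert (Hw := Cmod_ge_0 w).
  assert (T4 : 1 - Cmod w ^ 2 <= (1 - c ^ 2) + 2 * e) by nra.
  (* Multiply [S2] by [1 - r] and insert [T4], then [T2]: the right side becomes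
     [(1 - c ^ 2) * (1 - r + 2 * r)], and the factor [1 + r] cancels. *)
  assert (T5 : Cmod l * (1 - r) ^ 2 <= 1 - c ^ 2).
  { apply Rmult_le_reg_r with (1 + r); [lra |].
    replace (Cmod l * (1 - r) ^ 2 * (1 + r)) with (Cmod l * (1 - r ^ 2) * (1 - r)) by ring.
    apply Rle_trans with (((1 - c ^ 2) + 2 * e) * (1 - r)); [apply Rmult_le_compat_r |]; lra. }
  assert (HNc : N - c = N * (1 - c ^ 2)) by (unfold c; field; lra).
  assert (E1 : Cmod (f a - a)%C = N * (r * e)).
  { replace (f a - a)%C with (- (RtoC N * (a * (RtoC c - w))))%C.
    - rewrite Cmod_opp, !Cmod_mult, Cmod_R, Rabs_pos_eq by lra; reflexivity.
    - rewrite <- (scaled_slope_mult a); fold w; unfold c; rewrite RtoC_inv by lra.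
      field; intros E; apply RtoC_inj in E; lra. }
  assert (E2 : Cmod (a * f' a - f a)%C = N * (r * (r * Cmod l))).
  { rewrite <- Hlf, !Cmod_mult, Cmod_R, Rabs_pos_eq by lra; reflexivity. }
  rewrite E1, E2, HNc; split.
  - replace (N * (r * e) * (1 - r)) with (N * r * (e * (1 - r))) by ring.
    replace (N * (1 - c ^ 2) * r ^ 2) with (N * r * (r * (1 - c ^ 2))) by ring.
    apply Rmult_le_compat_l; [apply Rmult_le_pos |]; lra.
  - replace (N * (r * (r * Cmod l)) * (1 - r) ^ 2) with (N * r ^ 2 * (Cmod l * (1 - r) ^ 2)) by ring.
    replace (N * (1 - c ^ 2) * r ^ 2) with (N * r ^ 2 * (1 - c ^ 2)) by ring.
    apply Rmult_le_compat_l; [apply Rmult_le_pos; [lra | apply pow2_ge_0] | exact T5].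
Qed.
End Scaled.

(** The limit of [scaled_growth] as [N] decreases to [M]; at the origin both inequalities read
    [0 <= 0]. *)
Lemma growth (a : C) : Cmod a < 1 ->
  Cmod (f a - a)%C * (1 - Cmod a) <= (M - / M) * Cmod a ^ 2 /\
  Cmod (a * f' a - f a)%C * (1 - Cmod a) ^ 2 <= (M - / M) * Cmod a ^ 2.
Proof.
  intros Ha.
  destruct (excluded_middle_informative (a = RtoC 0)) as [->|Na].
  { replace (f (RtoC 0) - RtoC 0)%C with (RtoC 0) by (rewrite Hf0; ring).
    replace (RtoC 0 * f' (RtoC 0) - f (RtoC 0))%C with (RtoC 0) by (rewrite Hf0; ring).
    rewrite Cmod_0; split; right; ring. }
  apply Cmod_gt_0 in Na.
  (* Put [N = M / t] with [t] tending to 1 from below; multiplied by [t], the inequality is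
     polynomial in [t]. *)
  assert (Hlim : forall X K : R, (forall N, M < N -> X <= (N - / N) * K) -> X <= (M - / M) * K).
  { intros X K HX.
    enough (X * 1 - (M * 1 - 1 ^ 2 * 1 / M) * K <= 0) by lra.
    apply (left_limit_le (fun t => X * t - (M * 1 - t ^ 2 * 1 / M) * K) 0); [lra | reg; lra |].
    intros t Ht.
    specialize (HX (M / t) ltac:(apply Rlt_div_r; nra)).
    apply Rmult_le_compat_r with (r := t) in HX; [| lra].
    replace ((M / t - / (M / t)) * K * t) with ((M * 1 - t ^ 2 * 1 / M) * K) in HX by (field; lra).
    lra. }
  split; apply Hlim; intros N HN; apply (scaled_growth N HN a); lra.
Qed.
End BoundedNormalized.

(** * Mappings conj(z) G + H *)

(* Caratheodory form of real differentiability with [F_z = p] and [F_zbar = q]. *)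
Definition rdiff (F : C -> C) (z p q : C) : Prop := exists Phi, Phi z = p /\ ccont Phi z /\
  exists d, 0 < d /\ forall w, Cmod (w - z)%C < d ->
    F w = (F z + Phi w * (w - z) + q * Cconj (w - z))%C.

(** The increment of [Cconj w * G w] is [Cconj w * (G w - G z) + Cconj (w - z) * G z], whose second
    term is already of the antiholomorphic form. *)
Lemma rdiff_conj_mult_plus (G H : C -> C) (z g h : C) : cderiv G z g -> cderiv H z h ->
  rdiff (fun w => Cconj w * G w + H w)%C z (Cconj z * g + h)%C (G z).
Proof.
  intros [phi [<- [Hp [d1 [Hd1 H1]]]]] [psi [<- [Hq [d2 [Hd2 H2]]]]].
  exists (fun w => Cconj w * phi w + psi w)%C; split; [reflexivity |]; split.
  - apply ccont_plus; [apply ccont_mult; [apply ccont_conj | exact Hp] | exact Hq].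
  - exists (Rmin d1 d2); split; [apply Rmin_pos; assumption |]; intros w Hw.
    rewrite H1 by exact (Rlt_le_trans _ _ _ Hw (Rmin_l _ _)).
    rewrite H2 by exact (Rlt_le_trans _ _ _ Hw (Rmin_r _ _)).
    rewrite Cminus_conj; ring.
Qed.

(** The directional derivative as a bare estimate, shared by the complex valued derivative behind
    the Wirtinger derivatives and the real valued one used for univalence. *)
Lemma rdiff_line (F : C -> C) (z D p q : C) (t0 : R) : rdiff F (z + t0 * D)%C p q ->
  forall eps, 0 < eps -> exists d, 0 < d /\ forall t, Rabs (t - t0) < d ->
    Cmod (F (z + t * D) - F (z + t0 * D) - RtoC (t - t0) * (p * D + q * Cconj D))%C
      <= eps * Rabs (t - t0).
Proof.
  intros [Phi [Hp [Hc [d [Hd H]]]]] eps Heps.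
  (* The added 1 keeps the divisor positive when [D] is 0. *)
  set (K := Cmod D + 1).
  assert (HD := Cmod_ge_0 D); assert (HK : 0 < K) by (unfold K; lra).
  destruct (Hc (eps / K)) as [d1 [Hd1 H1]]; [apply Rdiv_lt_0_compat; lra |].
  assert (Hm := Rmin_pos d d1 Hd Hd1).
  exists (Rmin d d1 / K); split; [apply Rdiv_lt_0_compat; lra |]; intros t Ht.
  assert (Hw : (z + t * D - (z + t0 * D))%C = (RtoC (t - t0) * D)%C) by (rewrite RtoC_minus; ring).
  assert (Hlen : Cmod (z + t * D - (z + t0 * D))%C = Rabs (t - t0) * Cmod D)
    by (rewrite Hw, Cmod_mult, Cmod_R; reflexivity).
  assert (HR := Rabs_pos (t - t0)).
  assert (Hnear : Rabs (t - t0) * Cmod D < Rmin d d1).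
  { apply Rlt_div_r in Ht; [| exact HK]; unfold K in Ht.
    destruct (Req_dec (Rabs (t - t0)) 0) as [E|N]; [rewrite E; lra | lra]. }
  rewrite <- Hlen in Hnear.
  rewrite H by exact (Rlt_le_trans _ _ _ Hnear (Rmin_l _ _)).
  specialize (H1 _ (Rlt_le_trans _ _ _ Hnear (Rmin_r _ _))).
  rewrite Hw, Cmult_conj; rewrite Hp in H1.
  assert (HRc : Cconj (RtoC (t - t0)) = RtoC (t - t0)) by (apply injective_projections; simpl; ring).
  rewrite HRc.
  replace (_ - _ - _)%C with ((Phi (z + t * D)%C - p) * (RtoC (t - t0) * D))%C by ring.
  rewrite !Cmod_mult, Cmod_R.
  replace (eps * Rabs (t - t0)) with (eps / K * (Rabs (t - t0) * K)) by (field; lra).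
  apply Rmult_le_compat; [apply Cmod_ge_0 | apply Rmult_le_pos; lra | lra |].
  apply Rmult_le_compat_l; unfold K; lra.
Qed.

Lemma is_linear_scal_R (V : NormedModule R_AbsRing) (l : V) : is_linear (fun y : R => scal y l).
Proof. apply (is_linear_scal_l (K := R_AbsRing) (V := V)). Qed.

Lemma rdiff_is_derive (F : C -> C) (z D p q : C) : rdiff F z p q ->
  @is_derive R_AbsRing C_R_NormedModule (fun t => F (z + t * D)%C) 0 (p * D + q * Cconj D)%C.
Proof.
  intros HF; split; [apply is_linear_scal_R |]; intros x Hx.
  apply (is_filter_lim_locally_unique (V := AbsRing_NormedModule R_AbsRing)) in Hx; subst x; intros eps.
  destruct (rdiff_line F z D p q 0) with (eps := pos eps) as [d [Hd H]]; [| apply cond_pos |].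
  { replace (z + 0 * D)%C with z by ring; exact HF. }
  exists (mkposreal d Hd); intros t Ht.
  specialize (H t Ht).
  rewrite <- Cmod_norm.
  eapply Rle_trans; [| exact H]; right; apply f_equal.
  apply injective_projections; simpl; unfold minus, plus, opp, scal; simpl; unfold mult; simpl; ring.
Qed.

(** The directions 1 and [Ci] give [Fx = p + q] and [Fy = Ci * (p - q)]. *)
Lemma rdiff_wirtinger (F : C -> C) (z p q : C) : rdiff F z p q -> wirtinger F z p q.
Proof.
  intros HF.
  assert (Hx := rdiff_is_derive F z (RtoC 1) p q HF).
  assert (Hy := rdiff_is_derive F z Ci p q HF).
  eexists _, _; split; [split |].
  - eapply is_derive_ext; [| exact Hx]; intros t; simpl; f_equal; ring.
  - eapply is_derive_ext; [| exact Hy]; intros t; simpl; f_equal.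
    apply injective_projections; simpl; ring.
  - split; apply injective_projections; simpl; field.
Qed.

Lemma rdiff_re_is_derive (F : C -> C) (z D p q : C) (t0 : R) : rdiff F (z + t0 * D)%C p q ->
  @is_derive R_AbsRing R_NormedModule (fun t : R => Re (Cconj D * F (z + t * D))%C) t0 (Re (Cconj D * (p * D + q * Cconj D))%C).
Proof.
  intros HF; split; [apply is_linear_scal_R |]; intros x Hx.
  apply (is_filter_lim_locally_unique (V := AbsRing_NormedModule R_AbsRing)) in Hx; subst x; intros eps.
  set (K := Cmod D + 1).
  assert (HD := Cmod_ge_0 D); assert (HK : 0 < K) by (unfold K; lra).
  assert (He : 0 < eps / K) by (apply Rdiv_lt_0_compat; [apply cond_pos | exact HK]).
  destruct (rdiff_line F z D p q t0 HF _ He) as [d [Hd H]].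
  exists (mkposreal d Hd); intros t Ht.
  specialize (H t Ht).
  change (Rabs (Re (Cconj D * F (z + t * D))%C - Re (Cconj D * F (z + t0 * D))%C
    - (t - t0) * Re (Cconj D * (p * D + q * Cconj D))%C) <= eps * Rabs (t - t0)).
  replace (_ - _ - _) with (Re (Cconj D * (F (z + t * D) - F (z + t0 * D)
    - RtoC (t - t0) * (p * D + q * Cconj D)))%C).
  2:{ unfold Re; simpl; ring. }
  eapply Rle_trans; [apply re_le_Cmod |]; rewrite Cmod_mult, Cmod_conj.
  replace (eps * Rabs (t - t0)) with (K * (eps / K * Rabs (t - t0))) by (field; lra).
  apply Rmult_le_compat; [exact HD | apply Cmod_ge_0 | unfold K; lra | exact H].
Qed.

(* With [D = w - z], [Re (conj D F)] is strictly increasing along the segment from [z] to [w]. *)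
Lemma rdiff_univalent (F p q : C -> C) (r : R) :
  (forall z, Cmod z < r -> rdiff F z (p z) (q z) /\ Cmod (p z - 1)%C + Cmod (q z) < 1) ->
  univalent_in r F.
Proof.
  intros HF z w Hz Hw Heq; apply NNPP; intros Hne.
  set (D := (w - z)%C).
  assert (HD : 0 < Cmod D) by (apply Cmod_gt_0, Cminus_neq_0; auto).
  assert (Hseg : forall t, 0 <= t <= 1 -> Cmod (z + t * D)%C < r).
  { intros t Ht; replace (z + t * D)%C with (RtoC (1 - t) * z + t * w)%C
      by (unfold D; rewrite RtoC_minus; ring).
    eapply Rle_lt_trans; [apply Cmod_triangle |].
    rewrite !Cmod_mult, !Cmod_R, !Rabs_pos_eq by lra.
    (* At an end point one weight vanishes; strictness comes from the term whose weight is at least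
       [1 / 2]. *)
    destruct (Rle_dec t (1 / 2)); nra. }
  set (df := fun t : R => Re (Cconj D * (p (z + t * D)%C * D + q (z + t * D)%C * Cconj D))%C).
  set (ff := fun t : R => Re (Cconj D * F (z + t * D))%C).
  assert (Hder : forall t, 0 <= t <= 1 -> is_derive ff t (df t)).
  { intros t Ht; apply rdiff_re_is_derive, HF, Hseg, Ht. }
  destruct (MVT_gen ff 0 1 df) as [t [Ht HM]].
  - rewrite Rmin_left, Rmax_right by lra; intros t Ht; apply Hder; lra.
  - rewrite Rmin_left, Rmax_right by lra; intros t Ht.
    apply continuity_pt_filterlim, (ex_derive_continuous (V := R_NormedModule) ff t).
    eexists; apply Hder, Ht.
  - rewrite Rmin_left, Rmax_right in Ht by lra.
    assert (E : ff 1 = ff 0).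
    { unfold ff; replace (z + 1 * D)%C with w by (unfold D; ring).
      replace (z + 0 * D)%C with z by ring; rewrite Heq; reflexivity. }
    destruct (HF _ (Hseg t Ht)) as [_ Hpq].
    unfold df in HM; set (P := p (z + t * D)%C) in *; set (S := q (z + t * D)%C) in *.
    (* Splitting off [P = 1] bounds the derivative below by
       [Cmod D ^ 2 * (1 - Cmod (P - 1) - Cmod S)], which is positive, whereas [E] and the mean value
       theorem make it 0. *)
    assert (HX : Re (Cconj D * (P * D + S * Cconj D))%C
      = Cmod D ^ 2 + Re ((P - 1) * (D * Cconj D) + S * (Cconj D * Cconj D))%C).
    { rewrite Cmod2_alt; destruct P, S, D; simpl; ring. }
    assert (HY := re_le_Cmod ((P - 1) * (D * Cconj D) + S * (Cconj D * Cconj D))%C).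
    assert (HZ := Cmod_triangle ((P - 1) * (D * Cconj D)) (S * (Cconj D * Cconj D))).
    rewrite !Cmod_mult, Cmod_conj in HZ.
    apply Rabs_le_between in HY.
    assert (0 < Cmod D * Cmod D) by nra.
    assert (Cmod D * Cmod D * (Cmod (P - 1)%C + Cmod S) < Cmod D * Cmod D * 1)
      by (apply Rmult_lt_compat_l; assumption).
    rewrite HX in HM; lra.
Qed.

(** Both quotients increase with the radius and have nonnegative coefficients, and the term
    [- 2 * r] makes the decrease strict. *)
Lemma rho3_eq_pos (M1 M2 r s : R) : 0 <= M1 - / M1 -> 0 <= M2 - / M2 -> 0 < r < s -> s < 1 ->
  rho3_eq M1 M2 s = 0 -> 0 < rho3_eq M1 M2 r.
Proof.
  intros HA HB Hr Hs <-; unfold rho3_eq.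
  assert (Hinv : / (1 - r) ^ 2 <= / (1 - s) ^ 2).
  { apply Rinv_le_contravar; [apply pow_lt; lra | apply pow_incr; lra]. }
  assert (H0 : 0 < / (1 - r) ^ 2) by (apply Rinv_0_lt_compat, pow_lt; lra).
  assert (H1 : (2 * r - r ^ 2) / (1 - r) ^ 2 <= (2 * s - s ^ 2) / (1 - s) ^ 2).
  { apply Rmult_le_compat; try lra; nra. }
  assert (H2 : (3 - 2 * r) * r ^ 2 / (1 - r) ^ 2 <= (3 - 2 * s) * s ^ 2 / (1 - s) ^ 2).
  { apply Rmult_le_compat; try lra; [apply Rmult_le_pos; nra |].
    (* The difference of the numerators, factored so that every term is visibly nonnegative. *)
    enough (0 <= (s - r) * (2 * (s * (1 - s)) + 2 * (r * (1 - r)) + s * (1 - r) + r * (1 - s))) by lra.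
    apply Rmult_le_pos; [lra |]; nra. }
  apply (Rmult_le_compat_l _ _ _ HB) in H1; apply (Rmult_le_compat_l _ _ _ HA) in H2; lra.
Qed.

(** The quotient lies in the open disc of radius 1 about 1. *)
Lemma Cdiv_re_pos (A F : C) : Cmod (A - F)%C < Cmod F -> F <> RtoC 0 /\ 0 < Re (A / F)%C.
Proof.
  intros H; assert (HF : F <> RtoC 0) by (apply Cmod_gt_0; assert (P := Cmod_ge_0 (A - F)%C); lra).
  split; [exact HF |].
  replace (A / F)%C with (1 + (A - F) / F)%C by (field; exact HF).
  rewrite re_plus, re_RtoC.
  assert (HR := re_le_Cmod ((A - F) / F)%C); rewrite Cmod_div in HR by exact HF.
  apply Rabs_le_between in HR; apply Cmod_gt_0 in HF.
  assert (Cmod (A - F)%C / Cmod F < 1) by (apply Rlt_div_l; lra); lra.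
Qed.

Theorem theorem2p4 (M1 M2 : R) (G H : C -> C) (rho3 : R) :
  0 < M1 -> 0 < M2 ->
  holo_on 1 G -> holo_on 1 H ->
  (exists z : C, Cmod z < 1 /\ G z <> RtoC 0) ->
  G (RtoC 0) = RtoC 0 -> H (RtoC 0) = RtoC 0 ->
  @is_derive C_AbsRing C_NormedModule G (RtoC 0) (RtoC 1) ->
  @is_derive C_AbsRing C_NormedModule H (RtoC 0) (RtoC 1) ->
  (forall z : C, Cmod z < 1 -> Cmod (G z) <= M1) ->
  (forall z : C, Cmod z < 1 -> Cmod (H z) <= M2) ->
  0 < rho3 < 1 -> rho3_eq M1 M2 rho3 = 0 ->
  (forall r : R, 0 < r < 1 -> rho3_eq M1 M2 r = 0 -> r = rho3) ->
  let F := fun z : C => Cplus (Cmult (Cconj z) (G z)) (H z) in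
  sense_preserving_in rho3 F /\ univalent_in rho3 F /\ fully_starlike_in rho3 F.
Proof.
  intros HM1 HM2 HG HH _ HG0 HH0 HG1 HH1 HGb HHb Hrho Heq _ F.
  assert (Hder : forall K z, holo_on 1 K -> Cmod z < 1 -> cderiv K z (C_derive K z)).
  { intros K z HK Hz; apply is_derive_cderiv, C_derive_correct; auto. }
  assert (HdG := fun z => Hder G z HG); assert (HdH := fun z => Hder H z HH).
  assert (GG := growth G _ M1 HM1 HdG HG0 (is_derive_cderiv _ _ _ HG1) HGb).
  assert (GH := growth H _ M2 HM2 HdH HH0 (is_derive_cderiv _ _ _ HH1) HHb).
  (* The scaling parameter does not occur in the conclusion; [M1 + 1] is an arbitrary value above
     [M1]. *)
  assert (Hge1 : 1 <= M1) by exact (one_le_bound G _ M1 HM1 HdG HG0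
    (is_derive_cderiv _ _ _ HG1) HGb (M1 + 1) ltac:(lra)).
  assert (Hge2 : 1 <= M2) by exact (one_le_bound H _ M2 HM2 HdH HH0
    (is_derive_cderiv _ _ _ HH1) HHb (M2 + 1) ltac:(lra)).
  assert (Hcoef : forall M, 1 <= M -> 0 <= M - / M).
  { intros M HM; assert (/ M <= / 1) by (apply Rinv_le_contravar; lra).
    rewrite Rinv_1 in *; lra. }
  set (g' := C_derive G) in *; set (h' := C_derive H) in *.
  set (p := fun z => (Cconj z * g' z + h' z)%C).
  assert (HF : forall z, Cmod z < 1 -> rdiff F z (p z) (G z)).
  { intros z Hz; apply rdiff_conj_mult_plus; auto. }
  (* The one inequality behind all three conclusions. With [r = Cmod z], inserting the growth bounds
     on the left gives exactly [r - r * rho3_eq M1 M2 r], and [rho3_eq] is positive below [rho3]. *)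
  assert (key : forall z, 0 < Cmod z < rho3 ->
    Cmod (H z - z)%C + Cmod (z * h' z - H z)%C
      + Cmod z * (2 * Cmod (G z - z)%C + Cmod (z * g' z - G z)%C) + 2 * Cmod z ^ 2 < Cmod z).
  { intros z Hz; set (r := Cmod z) in *.
    assert (Hpos := rho3_eq_pos M1 M2 r rho3 (Hcoef _ Hge1) (Hcoef _ Hge2) Hz (proj2 Hrho) Heq).
    destruct (GG z ltac:(fold r; lra)) as [g1 g2]; destruct (GH z ltac:(fold r; lra)) as [h1 h2].
    fold r in g1, g2, h1, h2.
    apply Rle_div_r in g1, h1; try lra.
    apply Rle_div_r in g2, h2; try (apply pow_lt; lra).
    set (A := M1 - / M1) in *; set (B := M2 - / M2) in *.
    apply Rle_lt_trans with (r - r * rho3_eq M1 M2 r); [| nra].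
    replace (r - r * rho3_eq M1 M2 r)
      with (B * r ^ 2 / (1 - r) + B * r ^ 2 / (1 - r) ^ 2
        + r * (2 * (A * r ^ 2 / (1 - r)) + A * r ^ 2 / (1 - r) ^ 2) + 2 * r ^ 2)
      by (unfold rho3_eq; fold A B; field; lra).
    apply Rplus_le_compat_r, Rplus_le_compat; [lra |].
    apply Rmult_le_compat_l; lra. }
  assert (Hpq : forall z, Cmod z < rho3 -> Cmod (p z - 1)%C + Cmod (G z) < 1).
  { intros z Hz; destruct (excluded_middle_informative (z = RtoC 0)) as [->|Nz].
    - replace (p (RtoC 0)) with (RtoC 1).
      + replace (1 - 1)%C with (RtoC 0) by ring; rewrite HG0, Cmod_0; lra.
      + unfold p, h'; rewrite (is_C_derive_unique _ _ _ HH1).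
        apply injective_projections; simpl; ring.
    - apply Cmod_gt_0 in Nz; specialize (key z ltac:(lra)).
      apply Rmult_lt_reg_l with (Cmod z); [exact Nz |].
      (* Multiplication by [z] produces [z * h' z] and [z * g' z], which are then expanded around
         [z] into the quantities controlled by [key]. *)
      assert (E1 : Cmod z * Cmod (p z - 1)%C <= Cmod (H z - z)%C + Cmod (z * h' z - H z)%C
        + Cmod z * (Cmod z + Cmod (G z - z)%C + Cmod (z * g' z - G z)%C)).
      { rewrite <- Cmod_mult.
        replace (z * (p z - 1))%C with ((H z - z) + (z * h' z - H z)
          + Cconj z * (z + (G z - z) + (z * g' z - G z)))%C by (unfold p; ring).
        eapply Rle_trans; [apply Cmod_triangle |]; apply Rplus_le_compat; [apply Cmod_triangle |].
        rewrite Cmod_mult, Cmod_conj; apply Rmult_le_compat_l; [lra |].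
        eapply Rle_trans; [apply Cmod_triangle |]; apply Rplus_le_compat_r, Cmod_triangle. }
      assert (E2 : Cmod (G z) <= Cmod z + Cmod (G z - z)%C).
      { replace (G z) with (z + (G z - z))%C at 1 by ring; apply Cmod_triangle. }
      apply (Rmult_le_compat_l (Cmod z)) in E2; [nra | lra]. }
  assert (Hsense : sense_preserving_in rho3 F).
  { intros z Hz; exists (p z), (G z); split; [apply rdiff_wirtinger, HF; lra |].
    specialize (Hpq z Hz); unfold jac.
    (* The modulus of [p z] is at least [1 - Cmod (p z - 1)], which exceeds that of [G z]. *)
    assert (T := Cmod_triangle_rev (RtoC 1) (1 - p z)%C).
    rewrite Cmod_1, Cmod_minus_sym in T; replace (1 - (1 - p z))%C with (p z) in T by ring.
    assert (P := Cmod_ge_0 (G z)); nra. }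
  assert (Hstar : forall z, 0 < Cmod z < rho3 -> F z <> RtoC 0 /\
    0 < Re ((z * p z - Cconj z * G z) / F z)%C).
  { intros z Hz; apply Cdiv_re_pos; specialize (key z Hz).
    (* [E1] bounds the numerator minus [F z] from above and [E2] bounds [F z] from below; the two
       errors add up to the left side of [key], so the numerator is closer to [F z] than 0 is. *)
    assert (E1 : Cmod (z * p z - Cconj z * G z - F z)%C <=
      Cmod z * (Cmod (z * g' z - G z)%C + Cmod (G z - z)%C + Cmod z) + Cmod (z * h' z - H z)%C).
    { replace (z * p z - Cconj z * G z - F z)%C
        with (Cconj z * ((z * g' z - G z) - (G z - z) - z) + (z * h' z - H z))%C
        by (unfold p, F; ring).
      eapply Rle_trans; [apply Cmod_triangle |]; apply Rplus_le_compat_r.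
      rewrite Cmod_mult, Cmod_conj; apply Rmult_le_compat_l; [lra |].
      rewrite <- (Cmod_opp (G z - z)), <- (Cmod_opp z).
      eapply Rle_trans; [apply Cmod_triangle |]; apply Rplus_le_compat_r, Cmod_triangle. }
    assert (E2 : Cmod z <= Cmod (F z) + (Cmod (H z - z)%C + Cmod z * (Cmod z + Cmod (G z - z)%C))).
    { replace z with (F z + - ((H z - z) + Cconj z * (z + (G z - z))))%C at 1 by (unfold F; ring).
      eapply Rle_trans; [apply Cmod_triangle |]; apply Rplus_le_compat_l; rewrite Cmod_opp.
      eapply Rle_trans; [apply Cmod_triangle |]; apply Rplus_le_compat_l.
      rewrite Cmod_mult, Cmod_conj; apply Rmult_le_compat_l; [lra | apply Cmod_triangle]. }
    nra. }
  split; [exact Hsense |]; split.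
  - apply rdiff_univalent with p G; intros z Hz; split; [apply HF; lra | auto].
  - split; [exact Hsense |]; split; [| split].
    + unfold F; rewrite HG0, HH0; ring.
    + intros z Hz; apply Hstar, Hz.
    + intros z Hz; exists (p z), (G z); split; [apply rdiff_wirtinger, HF; lra | apply Hstar, Hz].
Qed.
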